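(* Let $R$ be a ring with identity. A chain complex $L$ of left (resp. right) $R$-modules is level if and only if $L^+ = \mathrm{Hom}_{\mathbb{Z}}(L,\mathbb{Q}/\mathbb{Z})$ is an absolutely clean complex of right (resp. left) $R$-modules. And a chain complex $A$ of left (resp. right) $R$-modules is absolutely clean if and only if $A^+ = \mathrm{Hom}_{\mathbb{Z}}(A,\mathbb{Q}/\mathbb{Z})$ is a level complex of right (resp. left) $R$-modules.
   Context: Chain complexes are $\mathbb{Z}$-graded and unbounded, with differentials lowering degree. For a complex $L$, $L^+=\mathrm{Hom}_{\mathbb{Z}}(L,\mathbb{Q}/\mathbb{Z})$ is the complex obtained by applying $\mathrm{Hom}_{\mathbb{Z}}(-,\mathbb{Q}/\mathbb{Z})$ degreewise, with $(L^+)_n=\mathrm{Hom}_{\mathbb{Z}}(L_{-n},\mathbb{Q}/\mathbb{Z})$. A chain complex is finitely generated if it is bounded and finitely generated in each degree. A chain complex of (left or right) modules is of type $FP_\infty$ if it has a projective resolution by finitely generated projective complexes (projective objects of the category of chain complexes). A chain complex $A$ of left $R$-modules is absolutely clean if $\mathrm{Ext}^1(X,A)=0$ (Ext in the category of chain complexes of left $R$-modules) for all chain complexes $X$ of left $R$-modules of type $FP_\infty$; similarly for right modules. For a complex $X$ of right $R$-modules and a complex $Y$ of left $R$-modules, let $X\otimes Y$ be the usual tensor product of complexes. The modified tensor product $X\overline{\otimes}Y$ is the complex of abelian groups whose degree $n$ entry is $(X\otimes Y)_n/B_n(X\otimes Y)$, where $B_n$ denotes the boundaries, with differential $\overline{x\otimes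 y}\mapsto \overline{dx\otimes y}$. It is right exact in each variable, and its left derived functors are denoted $\overline{\mathrm{Tor}}_i$. A chain complex $L$ of left $R$-modules is level if $\overline{\mathrm{Tor}}_1(X,L)=0$ for all chain complexes $X$ of right $R$-modules of type $FP_\infty$; level complexes of right $R$-modules are defined symmetrically (equivalently, as level complexes of left modules over the opposite ring). *)

(* Defs.v *)
From HB Require Import structures.
From mathcomp Require Import all_boot all_order all_algebra.
From mathcomp Require Import boolp classical_sets functions cardinality.
From mathcomp Require Import freeg.

Set Implicit Arguments.
Unset Strict Implicit.
Unset Printing Implicit Defensive.

Import GRing.Theory Num.Theory.
Local Open Scope ring_scope.
Local Open Scope quotient_scope.

(* A right R-module is an lmodType over the converse ring R^c: for x in such a
   module, x r is (r : R^c) *: x. *)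

Definition trivial_group (A : zmodType) : Prop := forall x : A, x = 0.

Section Product.
Variables (I : Type) (A : I -> zmodType).

Definition product : Type := forall i, A i.
Implicit Types f g h : product.

HB.instance Definition _ := gen_eqMixin product.
HB.instance Definition _ := gen_choiceMixin product.

Let addA : associative (fun f g : product => (fun i => f i + g i) : product).
Proof. by move=> f g h; apply: functional_extensionality_dep => i; rewrite addrA. Qed.
Let addC : commutative (fun f g : product => (fun i => f i + g i) : product).
Proof. by move=> f g; apply: functional_extensionality_dep => i; rewrite addrC. Qed.
Let add0 : left_id ((fun i => 0) : product) (fun f g => (fun i => f i + g i)).
Proof. by move=> f; apply: functional_extensionality_dep => i; rewrite add0r. Qed.
Let addN : left_inverse ((fun i => 0) : product) (fun f => (fun i => - f i))
  (fun f g => (fun i => f i + g i)).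
Proof. by move=> f; apply: functional_extensionality_dep => i; rewrite addNr. Qed.

HB.instance Definition _ := GRing.isZmodule.Build product addA addC add0 addN.

End Product.

Section DirectSum.
Variables (I : Type) (A : I -> zmodType).

Definition finite_support : {pred product A} :=
  fun f => `[< finite_set [set i | f i != 0]%classic >].

Fact finite_support_zmod_closed : zmod_closed finite_support.
Proof.
split=> [|f g /asboolP fF /asboolP gF]; apply/asboolP.
  by rewrite (_ : mkset _ = set0)%classic // -subset0 => i; rewrite /= eqxx.
apply: (@sub_finite_set _ _ ([set i | f i != 0] `|` [set i | g i != 0])%classic).
  move=> i; apply: contraPP => /not_orP[/= /negP/negPn/eqP fi0 /negP/negPn/eqP gi0].
  have fgi : (f - g) i = f i - g i by [].
  by rewrite /= fgi fi0 gi0 subrr eqxx.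
by rewrite finite_setU.
Qed.

HB.instance Definition _ :=
  GRing.isZmodClosed.Build (product A) finite_support finite_support_zmod_closed.

Record direct_sum := DirectSum {
  dsum_val :> product A;
  dsum_valP : dsum_val \in finite_support }.

HB.instance Definition _ := [isSub for dsum_val].
HB.instance Definition _ := [Choice of direct_sum by <:].
HB.instance Definition _ := [SubChoice_isSubZmodule of direct_sum by <:].

Lemma dsum_ext (a b : direct_sum) : (forall i, dsum_val a i = dsum_val b i) -> a = b.
Proof. by move=> ab; apply/val_inj/functional_extensionality_dep. Qed.

Lemma dsum_val0 i : dsum_val 0 i = 0. Proof. by []. Qed.
Lemma dsum_valN a i : dsum_val (- a) i = - dsum_val a i. Proof. by []. Qed.
Lemma dsum_valD a b i : dsum_val (a + b) i = dsum_val a i + dsum_val b i.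
Proof. by []. Qed.

End DirectSum.

Section DirectSumMap.
Variables (I J : Type) (A : I -> zmodType) (B : J -> zmodType).
Variables (s : J -> I) (s_inj : injective s).
Variable f : forall j, {additive A (s j) -> B j}.

Fact dsum_map_subproof (a : direct_sum A) :
  ((fun j => f j (dsum_val a (s j))) : product B) \in @finite_support J B.
Proof.
apply/asboolP; case: a => a /= /asboolP aF.
apply: (@sub_finite_set _ _ (s @^-1` [set i | a i != 0])%classic).
  by move=> j /=; apply: contra_neq => ->; rewrite raddf0.
by apply: finite_preimage => // x y _ _; apply: s_inj.
Qed.

Definition dsum_map (a : direct_sum A) : direct_sum B :=
  DirectSum (dsum_map_subproof a).

Fact dsum_map_is_zmod_morphism : zmod_morphism dsum_map.
Proof.
move=> a b; apply/val_inj/functional_extensionality_dep => j /=.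
exact: raddfB.
Qed.

HB.instance Definition _ :=
  GRing.isZmodMorphism.Build (direct_sum A) (direct_sum B) dsum_map
    dsum_map_is_zmod_morphism.

End DirectSumMap.

Section Subgroups.
Variables (A B : zmodType).

Definition additive_image (f : {additive A -> B}) : {pred B} :=
  fun y => `[< exists x, f x = y >].

Fact additive_image_zmod_closed f : zmod_closed (additive_image f).
Proof.
split=> [|x y /asboolP[a <-] /asboolP[b <-]]; apply/asboolP.
  by exists 0; rewrite raddf0.
by exists (a - b); rewrite raddfB.
Qed.

HB.instance Definition _ f :=
  GRing.isZmodClosed.Build B (additive_image f) (additive_image_zmod_closed f).

Definition additive_kernel (f : {additive A -> B}) : {pred A} := fun x => f x == 0.

Fact additive_kernel_zmod_closed f : zmod_closed (additive_kernel f).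
Proof.
split=> [|x y /eqP fx /eqP fy]; apply/eqP; first by rewrite raddf0.
by rewrite raddfB fx fy subr0.
Qed.

HB.instance Definition _ f :=
  GRing.isZmodClosed.Build A (additive_kernel f) (additive_kernel_zmod_closed f).

Definition generated (S : A -> Prop) : {pred A} :=
  fun x => `[< forall I : zmodClosed A, (forall s, S s -> s \in I) -> x \in I >].

Fact generated_zmod_closed S : zmod_closed (generated S).
Proof.
split=> [|x y /asboolP xS /asboolP yS]; apply/asboolP => I SI.
  exact: rpred0.
by apply: rpredB; [apply: xS | apply: yS].
Qed.

HB.instance Definition _ S :=
  GRing.isZmodClosed.Build A (generated S) (generated_zmod_closed S).

End Subgroups.

Section QuotientLift.
Variables (A B : zmodType) (I : zmodClosed A) (f : {additive A -> B}).

Definition quot_lift (fI : forall x, x \in I -> f x = 0) :=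
  fun q : Quotient.quot I => f (repr q).

Lemma quot_liftE fI x : quot_lift fI (\pi x) = f x.
Proof.
apply/eqP; rewrite -subr_eq0 -raddfB fI //.
by rewrite Quotient.idealrBE reprK.
Qed.

Fact quot_lift_is_zmod_morphism fI : zmod_morphism (quot_lift fI).
Proof.
elim/quotW=> x; elim/quotW=> y.
by rewrite -raddfB !quot_liftE raddfB.
Qed.

HB.instance Definition _ fI :=
  GRing.isZmodMorphism.Build (Quotient.quot I) B (quot_lift fI)
    (quot_lift_is_zmod_morphism fI).

End QuotientLift.

Section QuotientMap.
Variables (A B : zmodType) (I : zmodClosed A) (J : zmodClosed B).
Variable f : {additive A -> B}.

Fact quot_map_subproof (fIJ : forall x, x \in I -> f x \in J) x :
  x \in I -> (\pi_(Quotient.quot J) \o f) x = 0.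
Proof.
move=> /fIJ fxJ; rewrite /= -(raddf0 (\pi_(Quotient.quot J))).
by apply/eqP; rewrite -Quotient.idealrBE subr0.
Qed.

Definition quot_map (fIJ : forall x, x \in I -> f x \in J) :
    {additive Quotient.quot I -> Quotient.quot J} :=
  quot_lift (quot_map_subproof fIJ).

Lemma quot_mapE fIJ x :
  quot_map fIJ (\pi_(Quotient.quot I) x) = \pi_(Quotient.quot J) (f x).
Proof. exact: quot_liftE. Qed.

End QuotientMap.

Section Homology.
Variables (A B C : zmodType) (f : {additive A -> B}) (g : {additive B -> C}).

Record cycle := Cycle {
  cycle_val :> B;
  cycle_valP : cycle_val \in additive_kernel g }.

HB.instance Definition _ := [isSub for cycle_val].
HB.instance Definition _ := [Choice of cycle by <:].
HB.instance Definition _ := [SubChoice_isSubZmodule of cycle by <:].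

Definition bounding : {pred cycle} := fun z => cycle_val z \in additive_image f.

Fact bounding_zmod_closed : zmod_closed bounding.
Proof.
split=> [|x y xf yf]; rewrite unfold_in /= ?rpred0 //.
exact: rpredB.
Qed.

HB.instance Definition _ :=
  GRing.isZmodClosed.Build cycle bounding bounding_zmod_closed.

Definition homology : zmodType := Quotient.quot bounding.

End Homology.

Section Tensor.
Variables (R : pzRingType) (M : lmodType R^c) (N : lmodType R).

Inductive tensor_relation : {freeg (M * N)%type / int} -> Prop :=
| TensorAddl x x' y :
    tensor_relation (<< (x + x', y) >> - << (x, y) >> - << (x', y) >>)
| TensorAddr x y y' :
    tensor_relation (<< (x, y + y') >> - << (x, y) >> - << (x, y') >>)
| TensorScale (r : R) x y :
    tensor_relation (<< ((r : R^c) *: x, y) >> - << (x, r *: y) >>).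

Definition tensor : zmodType := Quotient.quot (generated tensor_relation).

Definition tens (x : M) (y : N) : tensor :=
  \pi_(Quotient.quot (generated tensor_relation)) << (x, y) >>.

Variables (A : zmodType) (b : M -> N -> A).

Definition balanced : Prop :=
  [/\ forall x x' y, b (x + x') y = b x y + b x' y,
      forall x y y', b x (y + y') = b x y + b x y'
    & forall (r : R) x y, b ((r : R^c) *: x) y = b x (r *: y)].

Definition tensor_prelift (z : {freeg (M * N)%type / int}) : A :=
  fglift (fun p => b p.1 p.2 : zmodule A) z.

Fact tensor_prelift_is_zmod_morphism : zmod_morphism tensor_prelift.
Proof. exact: (@lift_is_additive _ _ (zmodule A) (fun p => b p.1 p.2)). Qed.

HB.instance Definition _ :=
  GRing.isZmodMorphism.Build {freeg (M * N)%type / int} A tensor_prelift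
    tensor_prelift_is_zmod_morphism.

Lemma tensor_preliftE x y : tensor_prelift << (x, y) >> = b x y.
Proof. by rewrite /tensor_prelift liftU scale1r. Qed.

Lemma additive_kernel_generated (f : {additive {freeg (M * N)%type / int} -> A}) :
  (forall z, tensor_relation z -> f z = 0) ->
  forall z, z \in generated tensor_relation -> f z = 0.
Proof.
move=> f0 z /asboolP/(_ (additive_kernel f)) fz.
by apply/eqP/fz => s /f0/eqP.
Qed.

Fact tensor_lift_subproof (bB : balanced) z :
  z \in generated tensor_relation -> tensor_prelift z = 0.
Proof.
apply: additive_kernel_generated => {}z; case: bB => bl br bs.
case=> *; rewrite !raddfB /= !tensor_preliftE.
- by rewrite bl -addrA -opprD subrr.
- by rewrite br -addrA -opprD subrr.
- by rewrite bs subrr.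
Qed.

Definition tensor_lift (bB : balanced) : {additive tensor -> A} :=
  quot_lift (tensor_lift_subproof bB).

Lemma tensor_liftE (bB : balanced) x y : tensor_lift bB (tens x y) = b x y.
Proof. by rewrite [LHS]quot_liftE /= tensor_preliftE. Qed.

End Tensor.

Lemma tens_balanced (R : pzRingType) (M : lmodType R^c) (N : lmodType R) :
  balanced (@tens R M N).
Proof.
split=> *; apply/eqP; rewrite /tens -?raddfD -Quotient.idealrBE ?opprD ?addrA.
- by apply/asboolP => I; apply; apply: TensorAddl.
- by apply/asboolP => I; apply; apply: TensorAddr.
- by apply/asboolP => I; apply; apply: TensorScale.
Qed.

Section TensorMap.
Variables (R : pzRingType) (M M' : lmodType R^c) (N N' : lmodType R).
Variables (f : {linear M -> M'}) (g : {linear N -> N'}).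

Fact tensor_map_subproof : balanced (fun x y => tens (f x) (g y)).
Proof.
have [bl br bs] := @tens_balanced R M' N'.
by split=> *; rewrite ?linearD ?linearZ /= ?bl ?br ?bs.
Qed.

Definition tensor_map : {additive tensor M N -> tensor M' N'} :=
  tensor_lift tensor_map_subproof.

End TensorMap.

Arguments tensor_map : simpl never.

Section TensorExt.
Variables (R : pzRingType) (M : lmodType R^c) (N : lmodType R) (A : zmodType).

Lemma tensor_ext (f g : {additive tensor M N -> A}) :
  (forall x y, f (tens x y) = g (tens x y)) -> f =1 g.
Proof.
move=> fg; elim/quotW=> z; rewrite -(freeg_sumE z) !raddf_sum.
apply: eq_bigr => -[x y] _; set c := coeff _ _.
have -> : << c *g (x, y) >> = << (x, y) >> *~ c :> {freeg (M * N)%type / int}.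
  by rewrite freeg_mulz intz.
by rewrite !raddfMz; congr (_ *~ _); apply: fg.
Qed.

End TensorExt.

Lemma tensor_mapE (R : pzRingType) (M M' : lmodType R^c) (N N' : lmodType R)
    (f : {linear M -> M'}) (g : {linear N -> N'}) x y :
  tensor_map f g (tens x y) = tens (f x) (g y).
Proof. exact: tensor_liftE. Qed.

Section TensorMapTheory.
Variables (R : pzRingType) (M M' M'' : lmodType R^c) (N N' N'' : lmodType R).

Lemma tensor_map_comp (f' : {linear M' -> M''}) (g' : {linear N' -> N''})
    (f : {linear M -> M'}) (g : {linear N -> N'}) :
  forall z, tensor_map f' g' (tensor_map f g z) = tensor_map (f' \o f) (g' \o g) z.
Proof.
apply: (@tensor_ext _ _ _ _ (tensor_map f' g' \o tensor_map f g)) => x y.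
change (tensor_map f' g' (tensor_map f g (tens x y))
  = tensor_map (f' \o f) (g' \o g) (tens x y)).
by rewrite !tensor_mapE.
Qed.

Lemma tensor_map_eq (f f' : {linear M -> M'}) (g g' : {linear N -> N'}) :
  f =1 f' -> g =1 g' -> tensor_map f g =1 tensor_map f' g'.
Proof. by move=> ff gg; apply: tensor_ext => x y; rewrite !tensor_mapE ff gg. Qed.

Lemma tens0l y : @tens R M N 0 y = 0.
Proof.
have [bl _ _] := @tens_balanced R M N.
by apply: (addrI (tens 0 y)); rewrite -bl !addr0.
Qed.

Lemma tens0r x : @tens R M N x 0 = 0.
Proof.
have [_ br _] := @tens_balanced R M N.
by apply: (addrI (tens x 0)); rewrite -br !addr0.
Qed.

End TensorMapTheory.

Section TensorMapZero.
Variables (R : pzRingType) (M M' : lmodType R^c) (N N' : lmodType R).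
Variables (f : {linear M -> M'}) (g : {linear N -> N'}).

Lemma tensor_map0l z : (forall x, f x = 0) -> tensor_map f g z = 0.
Proof.
move=> f0; apply: (@tensor_ext _ _ _ _ _ (\0 : {additive _ -> _})) => x y.
by rewrite tensor_mapE f0 tens0l.
Qed.

Lemma tensor_map0r z : (forall x, g x = 0) -> tensor_map f g z = 0.
Proof.
move=> g0; apply: (@tensor_ext _ _ _ _ _ (\0 : {additive _ -> _})) => x y.
by rewrite tensor_mapE g0 tens0r.
Qed.

End TensorMapZero.

Record chain_complex (R : pzRingType) := ChainComplex {
  cobj :> int -> lmodType R;
  (* The equation m = n + 1 is an argument so that no transport between the
     modules of index -(n + 1) + 1 and -n is needed in the dual complex. *)
  cdiff : forall m n, m = n + 1 -> {linear cobj m -> cobj n};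
  cdiffK : forall l m n (lm : l = m + 1) (mn : m = n + 1) x,
    cdiff mn (cdiff lm x) = 0 }.
Arguments cdiff {R} c {m n} mn : rename.

Section ChainMaps.
Variables (R : pzRingType) (X Y : chain_complex R).

Definition degree_map : zmodType := product (fun n => product (fun _ : X n => Y n)).

Definition is_chain_map (f : forall n, X n -> Y n) : Prop :=
  (forall n, linear (f n)) /\
  (forall m n (mn : m = n + 1) x, f n (cdiff X mn x) = cdiff Y mn (f m x)).

Definition chain_map_pred : {pred degree_map} := fun f => `[< is_chain_map f >].

Fact chain_map_zmod_closed : zmod_closed chain_map_pred.
Proof.
split=> [|f g /asboolP[fL fd] /asboolP[gL gd]]; apply/asboolP; split.
- by move=> n a x y; rewrite [LHS]/0 scaler0 addr0.
- by move=> m n mn x; rewrite [RHS](raddf0 (cdiff Y mn)).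
- move=> n a x y; have E z : (f - g) n z = f n z - g n z by [].
  by rewrite !E fL gL scalerBr addrACA opprD.
- move=> m n mn x; have E k z : (f - g) k z = f k z - g k z by [].
  by rewrite !E fd gd raddfB.
Qed.

HB.instance Definition _ :=
  GRing.isZmodClosed.Build degree_map chain_map_pred chain_map_zmod_closed.

Record chain_map := ChainMap {
  chain_map_val : degree_map;
  chain_map_valP : chain_map_val \in chain_map_pred }.

HB.instance Definition _ := [isSub for chain_map_val].
HB.instance Definition _ := [Choice of chain_map by <:].
HB.instance Definition _ := [SubChoice_isSubZmodule of chain_map by <:].

Definition cmap (f : chain_map) n : X n -> Y n := @chain_map_val f n.
Arguments cmap : clear implicits.

Fact cmap_is_linear f n : linear (cmap f n).
Proof. by have /asboolP[] := chain_map_valP f. Qed.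

HB.instance Definition _ f n :=
  GRing.isLinear.Build R (X n) (Y n) _ (cmap f n) (@cmap_is_linear f n).

Lemma cmapE f m n (mn : m = n + 1) x :
  cmap f n (cdiff X mn x) = cdiff Y mn (cmap f m x).
Proof. by have /asboolP[] := chain_map_valP f. Qed.

End ChainMaps.
Arguments cmap {R X Y} f n.

Section Precomposition.
Variables (R : pzRingType) (X Y : chain_complex R).

Fact precomp_subproof (f : chain_map X Y) A (h : chain_map Y A) :
  ((fun n x => cmap h n (cmap f n x)) : degree_map X A) \in @chain_map_pred R X A.
Proof.
apply/asboolP; split=> [n a x y|m n mn x]; first by rewrite !linearP.
by rewrite !cmapE.
Qed.

Definition precomp (f : chain_map X Y) A (h : chain_map Y A) : chain_map X A :=
  ChainMap (precomp_subproof f h).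

Fact precomp_is_zmod_morphism f A : zmod_morphism (@precomp f A).
Proof. by move=> g h; apply/val_inj. Qed.

HB.instance Definition _ f A :=
  GRing.isZmodMorphism.Build (chain_map Y A) (chain_map X A) (@precomp f A)
    (@precomp_is_zmod_morphism f A).

End Precomposition.

Section Resolutions.
Variable R : pzRingType.
Implicit Types X Y Z P A : chain_complex R.

Definition epi X Y (f : chain_map X Y) : Prop :=
  forall n (y : Y n), exists x : X n, cmap f n x = y.

Definition projective P : Prop :=
  forall Y Z (g : chain_map Y Z) (f : chain_map P Z), epi g ->
    exists h : chain_map P Y, precomp h g = f.

Definition fg_module (M : lmodType R) : Prop :=
  exists (k : nat) (e : 'I_k -> M),
    forall x : M, exists c : 'I_k -> R, x = \sum_(i < k) c i *: e i.

Definition bounded X : Prop :=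
  exists N : int, forall n : int, N < `|n| -> trivial_group (X n).

Definition fg_complex X : Prop := bounded X /\ forall n, fg_module (X n).

Record projective_resolution X := ProjectiveResolution {
  res_obj :> nat -> chain_complex R;
  res_diff : forall k, chain_map (res_obj k.+1) (res_obj k);
  res_aug : chain_map (res_obj 0%N) X;
  res_projective : forall k, projective (res_obj k);
  res_aug_epi : epi res_aug;
  res_exact0 : forall n (x : res_obj 0%N n),
    cmap res_aug n x = 0 <-> exists y, cmap (res_diff 0%N) n y = x;
  res_exactS : forall k n (x : res_obj k.+1 n),
    cmap (res_diff k) n x = 0 <-> exists y, cmap (res_diff k.+1) n y = x }.

Definition FP_infinity X : Prop :=
  exists P : projective_resolution X, forall k, fg_complex (P k).

(* The cohomology at Hom(P_1, A) of Hom(P_0, A) -> Hom(P_1, A) -> Hom(P_2, A). *)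
Definition Ext1 X (P : projective_resolution X) A : zmodType :=
  homology (@precomp R _ _ (res_diff P 0%N) A) (@precomp R _ _ (res_diff P 1%N) A).

Definition absolutely_clean A : Prop :=
  forall X, FP_infinity X ->
  forall P : projective_resolution X, trivial_group (Ext1 P A).

End Resolutions.

Section AdditiveOverInt.
Variables (A B : zmodType) (f : {additive A -> B}).

Definition zlinear_fun (x : zmodule A) : zmodule B := f x.

Fact zlinear_fun_is_linear : linear zlinear_fun.
Proof. by move=> a x y; rewrite /zlinear_fun raddfD [f _]raddfMz. Qed.

HB.instance Definition _ :=
  GRing.isLinear.Build int (zmodule A) (zmodule B) _ zlinear_fun
    zlinear_fun_is_linear.

Definition zlinear : {linear zmodule A -> zmodule B} := zlinear_fun.

End AdditiveOverInt.

Definition koszul_sign (i : int) : int := (-1) ^+ `|i|%N.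

Lemma koszul_signS i : koszul_sign (i + 1) = - koszul_sign i.
Proof.
rewrite /koszul_sign; case: i => [k|[|k]]; rewrite ?NegzE.
- by rewrite -PoszD addn1 /= exprS mulN1r.
- by rewrite addNr /= expr1 opprK expr0.
have -> : - k.+2%:Z + 1 = - k.+1%:Z by rewrite -[k.+2]addn1 PoszD opprD addrNK.
by rewrite !abszN /= [in RHS]exprS mulN1r opprK.
Qed.

Section KoszulMap.
Variables (i : int) (A B : zmodType) (f : {additive A -> B}).

Definition koszul_fun (x : A) : B := f x *~ koszul_sign i.

Fact koszul_fun_is_zmod_morphism : zmod_morphism koszul_fun.
Proof. by move=> x y; rewrite /koszul_fun raddfB mulrzBl. Qed.

HB.instance Definition _ :=
  GRing.isZmodMorphism.Build A B koszul_fun koszul_fun_is_zmod_morphism.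

Definition koszul_map : {additive A -> B} := koszul_fun.

Lemma koszul_mapE x : koszul_map x = f x *~ koszul_sign i.
Proof. by []. Qed.

End KoszulMap.

Record bidegree (n : int) := Bidegree {
  deg1 : int;
  deg2 : int;
  bidegreeP : deg1 + deg2 == n }.

Section BidegreeShift.
Variables (m n : int) (mn : m = n + 1).

Fact shiftl_subproof (p : bidegree n) : deg1 p + 1 + deg2 p == m.
Proof. by case: p => i j /= /eqP ij; rewrite mn -ij addrAC. Qed.

Fact shiftr_subproof (p : bidegree n) : deg1 p + (deg2 p + 1) == m.
Proof. by case: p => i j /= /eqP ij; rewrite mn -ij addrA. Qed.

Definition shiftl (p : bidegree n) : bidegree m := Bidegree (shiftl_subproof p).

Definition shiftr (p : bidegree n) : bidegree m := Bidegree (shiftr_subproof p).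

Lemma shiftl_inj : injective shiftl.
Proof.
move=> [i j ij] [k l kl] [/addIr ik jl]; case: _ / ik kl => kl.
by case: _ / jl kl => kl; rewrite (bool_irrelevance ij kl).
Qed.

Lemma shiftr_inj : injective shiftr.
Proof.
move=> [i j ij] [k l kl] [ik /addIr jl]; case: _ / ik kl => kl.
by case: _ / jl kl => kl; rewrite (bool_irrelevance ij kl).
Qed.

End BidegreeShift.

Section TensorComplex.
Variables (R : pzRingType) (X : chain_complex R^c) (Y : chain_complex R).

Definition tensor_term n (p : bidegree n) : zmodType :=
  tensor (X (deg1 p)) (Y (deg2 p)).

Definition tensor_degree n : zmodType := direct_sum (@tensor_term n).

Section Differentials.
Variables (m n : int) (mn : m = n + 1).

(* x (x) y |-> dx (x) y *)
Definition tensor_dl : {additive tensor_degree m -> tensor_degree n} :=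
  dsum_map (A := @tensor_term m) (B := @tensor_term n) (@shiftl_inj m n mn)
    (fun p => tensor_map (cdiff X (erefl (deg1 p + 1))) idfun).

(* x (x) y |-> (-1)^|x| x (x) dy *)
Definition tensor_dr : {additive tensor_degree m -> tensor_degree n} :=
  dsum_map (A := @tensor_term m) (B := @tensor_term n) (@shiftr_inj m n mn)
    (fun p => koszul_map (deg1 p)
       (tensor_map idfun (cdiff Y (erefl (deg2 p + 1))))).

Definition tensor_d : {additive tensor_degree m -> tensor_degree n} :=
  tensor_dl \+ tensor_dr.

Lemma tensor_dlE t p : dsum_val (tensor_dl t) p =
  tensor_map (cdiff X (erefl (deg1 p + 1))) idfun (dsum_val t (shiftl mn p)).
Proof. by []. Qed.

Lemma tensor_drE t p : dsum_val (tensor_dr t) p =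
  tensor_map idfun (cdiff Y (erefl (deg2 p + 1))) (dsum_val t (shiftr mn p))
    *~ koszul_sign (deg1 p).
Proof. by []. Qed.

End Differentials.

Lemma tensor_dl_dl l m n (lm : l = m + 1) (mn : m = n + 1) t :
  tensor_dl mn (tensor_dl lm t) = 0.
Proof.
apply: dsum_ext => p; rewrite !tensor_dlE dsum_val0 tensor_map_comp.
by apply: tensor_map0l => x /=; rewrite cdiffK.
Qed.

Lemma tensor_dr_dr l m n (lm : l = m + 1) (mn : m = n + 1) t :
  tensor_dr mn (tensor_dr lm t) = 0.
Proof.
apply: dsum_ext => p; rewrite !tensor_drE dsum_val0 raddfMz tensor_map_comp.
by rewrite tensor_map0r ?mul0rz // => x /=; rewrite cdiffK.
Qed.

Lemma tensor_dl_dr l m n (lm : l = m + 1) (mn : m = n + 1) t :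
  tensor_dl mn (tensor_dr lm t) = - tensor_dr mn (tensor_dl lm t).
Proof.
apply: dsum_ext => p; rewrite dsum_valN tensor_dlE !tensor_drE tensor_dlE.
rewrite raddfMz koszul_signS mulrNz !tensor_map_comp.
congr (- (_ *~ _)).
have irr (e1 e2 : deg1 p + 1 + (deg2 p + 1) == l) :
    tensor_map (cdiff X (erefl (deg1 p + 1))) (cdiff Y (erefl (deg2 p + 1)))
      (dsum_val t (Bidegree e1)) =
    tensor_map (cdiff X (erefl (deg1 p + 1))) (cdiff Y (erefl (deg2 p + 1)))
      (dsum_val t (Bidegree e2)).
  by rewrite (bool_irrelevance e1 e2).
have := irr (shiftr_subproof lm (shiftl mn p)) (shiftl_subproof lm (shiftr mn p)).
move=> E; apply: etrans (etrans E _); first exact: tensor_map_eq.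
by apply: esym; apply: tensor_map_eq.
Qed.

Lemma tensor_d_d l m n (lm : l = m + 1) (mn : m = n + 1) t :
  tensor_d mn (tensor_d lm t) = 0.
Proof.
rewrite /tensor_d /= !raddfD tensor_dl_dl tensor_dr_dr tensor_dl_dr.
by rewrite add0r addr0 addNr.
Qed.

Definition tensor_complex : chain_complex int :=
  ChainComplex (cobj := fun n => zmodule (tensor_degree n))
    (cdiff := fun m n mn => zlinear (tensor_d mn)) tensor_d_d.

End TensorComplex.

Section TensorComplexMap.
Variables (R : pzRingType).
Variables (X X' : chain_complex R^c) (Y Y' : chain_complex R).
Variables (f : chain_map X X') (g : chain_map Y Y').

Definition tensor_degree_map n :
    {additive tensor_degree X Y n -> tensor_degree X' Y' n} :=
  dsum_map (A := @tensor_term _ X Y n) (B := @tensor_term _ X' Y' n)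
    (@inj_id (bidegree n))
    (fun p => tensor_map (cmap f (deg1 p)) (cmap g (deg2 p))).

Lemma tensor_degree_mapE n t p : dsum_val (tensor_degree_map n t) p =
  tensor_map (cmap f (deg1 p)) (cmap g (deg2 p)) (dsum_val t p).
Proof. by []. Qed.

Variables (m n : int) (mn : m = n + 1).

Lemma tensor_degree_map_dl t :
  tensor_degree_map n (tensor_dl X Y mn t) = tensor_dl X' Y' mn (tensor_degree_map m t).
Proof.
apply: dsum_ext => p; rewrite tensor_degree_mapE !tensor_dlE tensor_degree_mapE.
by rewrite !tensor_map_comp; apply: tensor_map_eq => // x /=; rewrite cmapE.
Qed.

Lemma tensor_degree_map_dr t :
  tensor_degree_map n (tensor_dr X Y mn t) = tensor_dr X' Y' mn (tensor_degree_map m t).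
Proof.
apply: dsum_ext => p; rewrite tensor_degree_mapE !tensor_drE tensor_degree_mapE.
rewrite raddfMz !tensor_map_comp; congr (_ *~ _).
by apply: tensor_map_eq => // x /=; rewrite cmapE.
Qed.

Lemma tensor_degree_map_d t :
  tensor_degree_map n (tensor_d X Y mn t) = tensor_d X' Y' mn (tensor_degree_map m t).
Proof. by rewrite /tensor_d /= raddfD tensor_degree_map_dl tensor_degree_map_dr. Qed.

End TensorComplexMap.

Definition boundaries (R : pzRingType) (X : chain_complex R) (n : int) :
    zmodClosed (X n) :=
  additive_image (cdiff X (erefl (n + 1))).

Section BarTensor.
Variables (R : pzRingType) (X : chain_complex R^c) (Y : chain_complex R).

Definition bar_degree n : zmodType :=
  Quotient.quot (boundaries (tensor_complex X Y) n).

Fact bar_d_subproof m n (mn : m = n + 1) t :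
  t \in boundaries (tensor_complex X Y) m ->
  tensor_dl X Y mn t \in boundaries (tensor_complex X Y) n.
Proof.
move=> /asboolP[u <-]; apply/asboolP; subst m.
exists (- tensor_dl X Y (erefl (n + 1 + 1)) u).
change (tensor_d X Y (erefl (n + 1)) (- tensor_dl X Y (erefl (n + 1 + 1)) u)
  = tensor_dl X Y (erefl (n + 1)) (tensor_d X Y (erefl (n + 1 + 1)) u)).
by rewrite /tensor_d /= raddfD !raddfN !tensor_dl_dl tensor_dl_dr oppr0 !add0r.
Qed.

(* x (x) y |-> dx (x) y on classes modulo boundaries. *)
Definition bar_d m n (mn : m = n + 1) : {additive bar_degree m -> bar_degree n} :=
  quot_map (f := tensor_dl X Y mn) (bar_d_subproof mn).

Fact bar_d_d l m n (lm : l = m + 1) (mn : m = n + 1) t :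
  bar_d mn (bar_d lm t) = 0.
Proof.
elim/quotW: t => t; rewrite /bar_d !quot_mapE tensor_dl_dl.
exact: raddf0.
Qed.

Definition bar_tensor : chain_complex int :=
  ChainComplex (cobj := fun n => zmodule (bar_degree n))
    (cdiff := fun m n mn => zlinear (bar_d mn)) bar_d_d.

End BarTensor.

Section BarTensorMap.
Variables (R : pzRingType).
Variables (X X' : chain_complex R^c) (Y Y' : chain_complex R).
Variables (f : chain_map X X') (g : chain_map Y Y').

Fact bar_tensor_map_subproof1 n t :
  t \in boundaries (tensor_complex X Y) n ->
  tensor_degree_map f g n t \in boundaries (tensor_complex X' Y') n.
Proof.
move=> /asboolP[u <-]; apply/asboolP.
by exists (tensor_degree_map f g _ u); rewrite /= /zlinear_fun tensor_degree_map_d.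
Qed.

Definition bar_tensor_degree_map n : {additive bar_degree X Y n -> bar_degree X' Y' n} :=
  quot_map (f := tensor_degree_map f g n) (@bar_tensor_map_subproof1 n).

Fact bar_tensor_map_subproof :
  ((fun n => bar_tensor_degree_map n) : degree_map (bar_tensor X Y) (bar_tensor X' Y'))
    \in @chain_map_pred int (bar_tensor X Y) (bar_tensor X' Y').
Proof.
apply/asboolP; split=> [n|m n mn t].
  exact: (zlinear_fun_is_linear (bar_tensor_degree_map n)).
elim/quotW: t => t; set q := \pi t.
change (bar_tensor_degree_map n (bar_d X Y mn q)
  = bar_d X' Y' mn (bar_tensor_degree_map m q)).
rewrite /bar_tensor_degree_map /bar_d !quot_mapE.
by rewrite tensor_degree_map_dl.
Qed.

Definition bar_tensor_map : chain_map (bar_tensor X Y) (bar_tensor X' Y') :=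
  ChainMap bar_tensor_map_subproof.

End BarTensorMap.

Section Identity.
Variables (R : pzRingType) (X : chain_complex R).

Fact chain_id_subproof :
  ((fun _ => id) : degree_map X X) \in @chain_map_pred R X X.
Proof. by apply/asboolP; split. Qed.

Definition chain_id : chain_map X X := ChainMap chain_id_subproof.

End Identity.

(* Degree n of the first left derived functor of the modified tensor product,
   computed from a projective resolution of the first (barTor1l) or of the
   second (barTor1r) variable. Like Ext1, its vanishing is required below for
   every resolution P; this is never vacuous, since FP_infinity X provides one. *)
Section Tor.
Variables (R : pzRingType) (X : chain_complex R^c) (Y : chain_complex R).

Definition barTor1l (P : projective_resolution X) (n : int) : zmodType :=
  homology (cmap (bar_tensor_map (res_diff P 1%N) (chain_id Y)) n)
           (cmap (bar_tensor_map (res_diff P 0%N) (chain_id Y)) n).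

Definition barTor1r (P : projective_resolution Y) (n : int) : zmodType :=
  homology (cmap (bar_tensor_map (chain_id X) (res_diff P 1%N)) n)
           (cmap (bar_tensor_map (chain_id X) (res_diff P 0%N)) n).

End Tor.

Section Level.
Variable R : pzRingType.

Definition left_level (L : chain_complex R) : Prop :=
  forall X : chain_complex R^c, FP_infinity X ->
  forall (P : projective_resolution X) n, trivial_group (barTor1l L P n).

Definition right_level (L : chain_complex R^c) : Prop :=
  forall X : chain_complex R, FP_infinity X ->
  forall (P : projective_resolution X) n, trivial_group (barTor1r L P n).

End Level.

Definition rat_integers : {pred rat} := fun x => x \is a Num.int.

Fact rat_integers_zmod_closed : zmod_closed rat_integers.
Proof. by split=> [|x y]; [exact: rpred0 | exact: rpredB]. Qed.

HB.instance Definition _ :=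
  GRing.isZmodClosed.Build rat rat_integers rat_integers_zmod_closed.

Definition QmodZ : zmodType := Quotient.quot rat_integers.

Section CharacterGroup.
Variable M : zmodType.

Definition is_character : {pred product (fun _ : M => QmodZ)} :=
  fun f => `[< zmod_morphism f >].

Fact is_character_zmod_closed : zmod_closed is_character.
Proof.
split=> [|f g /asboolP fL /asboolP gL]; apply/asboolP => x y.
  by rewrite [RHS]subr0.
have E z : (f - g) z = f z - g z by [].
by rewrite !E fL gL !opprD !opprK addrACA.
Qed.

HB.instance Definition _ := GRing.isZmodClosed.Build
  (product (fun _ : M => QmodZ)) is_character is_character_zmod_closed.

Record character := Character {
  character_val : product (fun _ : M => QmodZ);
  character_valP : character_val \in is_character }.

HB.instance Definition _ := [isSub for character_val].
HB.instance Definition _ := [Choice of character by <:].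
HB.instance Definition _ := [SubChoice_isSubZmodule of character by <:].

Definition character_fun (f : character) (x : M) : QmodZ := character_val f x.

Fact character_fun_is_zmod_morphism f : zmod_morphism (character_fun f).
Proof. exact: (asboolP _ (character_valP f)). Qed.

HB.instance Definition _ f := GRing.isZmodMorphism.Build M QmodZ (character_fun f)
  (character_fun_is_zmod_morphism f).

End CharacterGroup.

Section PullbackCharacter.
Variables (M N : zmodType) (h : {additive M -> N}).

Fact character_comp_subproof (f : character N) :
  ((fun x => character_fun f (h x)) : product (fun _ : M => QmodZ)) \in @is_character M.
Proof. by apply/asboolP => x y; rewrite !raddfB. Qed.

Definition character_comp (f : character N) : character M :=
  Character (character_comp_subproof f).

End PullbackCharacter.

Lemma character_ext (M : zmodType) (f g : character M) :
  (forall x, character_fun f x = character_fun g x) -> f = g.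
Proof. by move=> fg; apply/val_inj/functional_extensionality_dep. Qed.

(* The action of R^c on the characters of a left module: (f r)(x) = f (r x). *)
Section LeftCharacter.
Variables (R : pzRingType) (M : lmodType R).

Definition left_character : Type := character M.
HB.instance Definition _ := GRing.Zmodule.on left_character.

Definition left_character_scale (r : R^c) (f : left_character) : left_character :=
  character_comp ( *:%R (r : R)) f.

Fact left_character_scaleA (r s : R^c) f :
  left_character_scale r (left_character_scale s f) = left_character_scale (r * s) f.
Proof. by apply: character_ext => x; rewrite /character_fun /= scalerA. Qed.

Fact left_character_scale1 : left_id 1 left_character_scale.
Proof. by move=> f; apply: character_ext => x; rewrite /character_fun /= scale1r. Qed.

Fact left_character_scaleDr : right_distributive left_character_scale +%R.
Proof. by move=> r f g; apply: character_ext. Qed.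

Fact left_character_scaleDl f : {morph left_character_scale^~ f : r s / r + s}.
Proof.
move=> r s; apply: character_ext => x.
by rewrite [LHS](congr1 (character_fun f) (scalerDl _ _ _)) raddfD.
Qed.

HB.instance Definition _ := GRing.Zmodule_isLmodule.Build R^c left_character
  left_character_scaleA left_character_scale1 left_character_scaleDr
  left_character_scaleDl.

End LeftCharacter.

(* The action of R on the characters of a right module: (r f)(x) = f (x r). *)
Section RightCharacter.
Variables (R : pzRingType) (M : lmodType R^c).

Definition right_character : Type := character M.
HB.instance Definition _ := GRing.Zmodule.on right_character.

Definition right_character_scale (r : R) (f : right_character) : right_character :=
  character_comp ( *:%R (r : R^c)) f.

Fact right_character_scaleA (r s : R) f :
  right_character_scale r (right_character_scale s f) = right_character_scale (r * s) f.
Proof. by apply: character_ext => x; rewrite /character_fun /= scalerA. Qed.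

Fact right_character_scale1 : left_id 1 right_character_scale.
Proof. by move=> f; apply: character_ext => x; rewrite /character_fun /= scale1r. Qed.

Fact right_character_scaleDr : right_distributive right_character_scale +%R.
Proof. by move=> r f g; apply: character_ext. Qed.

Fact right_character_scaleDl f : {morph right_character_scale^~ f : r s / r + s}.
Proof.
move=> r s; apply: character_ext => x.
by rewrite [LHS](congr1 (character_fun f) (scalerDl _ _ _)) raddfD.
Qed.

HB.instance Definition _ := GRing.Zmodule_isLmodule.Build R right_character
  right_character_scaleA right_character_scale1 right_character_scaleDr
  right_character_scaleDl.

End RightCharacter.

Lemma dual_degree (m n : int) : m = n + 1 -> - n = - m + 1.
Proof. by move=> ->; rewrite opprD addrNK. Qed.

(* Hom_Z(-, Q/Z) applied degreewise: no sign is introduced in the differential. *)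
Section LeftDual.
Variables (R : pzRingType) (L : chain_complex R).

Definition left_dual_diff m n (mn : m = n + 1) (f : left_character (L (- m))) :
    left_character (L (- n)) :=
  character_comp (cdiff L (dual_degree mn)) f.

Fact left_dual_diff_is_linear m n mn : linear (@left_dual_diff m n mn).
Proof.
move=> r f g; apply: character_ext => x.
have E : character_fun f ((r : R) *: cdiff L (dual_degree mn) x) =
    character_fun f (cdiff L (dual_degree mn) ((r : R) *: x)) by rewrite linearZ.
exact: (congr1 (+%R^~ (character_fun g (cdiff L (dual_degree mn) x))) E).
Qed.

HB.instance Definition _ m n mn :=
  GRing.isLinear.Build R^c (left_character (L (- m))) (left_character (L (- n))) _
    (@left_dual_diff m n mn) (@left_dual_diff_is_linear m n mn).

Fact left_dual_diffK l m n (lm : l = m + 1) (mn : m = n + 1) f :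
  left_dual_diff mn (left_dual_diff lm f) = 0.
Proof.
apply: character_ext => x.
change (character_fun f (cdiff L (dual_degree lm) (cdiff L (dual_degree mn) x)) = 0).
by rewrite cdiffK raddf0.
Qed.

Definition left_dual : chain_complex R^c :=
  ChainComplex (cobj := fun n => left_character (L (- n)))
    (cdiff := fun m n mn => @left_dual_diff m n mn) left_dual_diffK.

End LeftDual.

Section RightDual.
Variables (R : pzRingType) (L : chain_complex R^c).

Definition right_dual_diff m n (mn : m = n + 1) (f : right_character (L (- m))) :
    right_character (L (- n)) :=
  character_comp (cdiff L (dual_degree mn)) f.

Fact right_dual_diff_is_linear m n mn : linear (@right_dual_diff m n mn).
Proof.
move=> r f g; apply: character_ext => x.
have E : character_fun f ((r : R^c) *: cdiff L (dual_degree mn) x) =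
    character_fun f (cdiff L (dual_degree mn) ((r : R^c) *: x)) by rewrite linearZ.
exact: (congr1 (+%R^~ (character_fun g (cdiff L (dual_degree mn) x))) E).
Qed.

HB.instance Definition _ m n mn :=
  GRing.isLinear.Build R (right_character (L (- m))) (right_character (L (- n))) _
    (@right_dual_diff m n mn) (@right_dual_diff_is_linear m n mn).

Fact right_dual_diffK l m n (lm : l = m + 1) (mn : m = n + 1) f :
  right_dual_diff mn (right_dual_diff lm f) = 0.
Proof.
apply: character_ext => x.
change (character_fun f (cdiff L (dual_degree lm) (cdiff L (dual_degree mn) x)) = 0).
by rewrite cdiffK raddf0.
Qed.

Definition right_dual : chain_complex R :=
  ChainComplex (cobj := fun n => right_character (L (- n)))
    (cdiff := fun m n mn => @right_dual_diff m n mn) right_dual_diffK.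

End RightDual.

(* Main.v *)
(* The characters of (P (x)~ L)_n are, after a change of sign, the families of
   balanced pairings P_i x L_(n-i) -> Q/Z with b (dx, y) = b (x, dy), i.e. the
   chain maps from a shift of P to L^+. As Q/Z is an injective cogenerator of
   abelian groups, Tor_1(X, L)_n vanishes iff Ext^1(X[-n], L^+) does, and X[-n]
   is of type FP_infinity when X is; so L is level iff L^+ is absolutely clean.
   Applied to L = A^+, this reduces the other equivalence to showing that A is
   absolutely clean iff A^++ is. A finitely generated projective complex P is a
   retract of the complex with R^m (+) R^m in each degree and differential
   (a, b) |-> (0, a); since P is bounded, it follows that
   Hom(P, A)^++ = Hom(P, A^++), and this is applied to a resolution of X by
   finitely generated projectives, on which the vanishing of Ext^1 may be tested. *)
From HB Require Import structures.
Require Import Defs.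
From mathcomp Require Import all_boot all_order all_algebra.
From mathcomp Require Import boolp classical_sets cardinality fsbigop.
From mathcomp Require Import finmap zify.

Set Implicit Arguments.
Unset Strict Implicit.
Unset Printing Implicit Defensive.

Import Order.TTheory GRing.Theory Num.Theory.

Local Open Scope ring_scope.
Local Open Scope quotient_scope.

(** The complex with R^m (+) R^m in each degree is free: a chain map from it to A is an arbitrary
    choice of m elements in each degree of A, and its component in degree n depends only on the
    choices in degrees n and n + 1. If P is a bounded retract of it, the identity of Hom(P, A) is
    therefore a finite sum of maps Hom(P, A) -> A_k -> Hom(P, A). These are built from scalars of R
    and differentials of A, so double transposition carries them to the same formulas for A^++; this
    is what makes the canonical map Hom(P, A)^++ -> Hom(P, A^++) bijective. Absolute cleanness
    quantifies over all projective resolutions, whereas finite generation is available for one of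
    them; a comparison of resolutions, in the few terms that Ext^1 sees, bridges the gap. *)

(** * Q/Z as an injective cogenerator of abelian groups *)

Lemma quot_pi_eq0 (A : zmodType) (I : zmodClosed A) x :
  \pi_(Quotient.quot I) x = 0 <-> x \in I.
Proof.
rewrite -[0](raddf0 (\pi_(Quotient.quot I))).
by split=> [/eqP|xI]; [|apply/eqP]; rewrite -Quotient.idealrBE subr0.
Qed.

Lemma rat_integers_pi (r : rat) : \pi_QmodZ r = 0 <-> r \is a Num.int.
Proof. exact: quot_pi_eq0. Qed.

Lemma QmodZ_divisible (n : int) (q : QmodZ) : n != 0 -> exists q', q' *~ n = q.
Proof.
move=> n0; elim/quotW: q => r; exists (\pi_QmodZ (r / n%:~R)).
by rewrite -raddfMz -mulrzr divfK // intr_eq0.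
Qed.

Lemma QmodZ_torsion (n : int) : `|n|%N != 1%N ->
  exists2 q : QmodZ, q != 0 & q *~ n = 0.
Proof.
(* The witness is the class of 1/n; for [n = 0], which kills everything, the class of 1/2 takes its
   place. *)
move=> n1; pose k := if n == 0 then 2 else n.
have [k0 k1 nk] : [/\ k != 0, `|k|%N != 1%N & exists m, n = m * k].
  rewrite /k; case: (eqVneq n 0) => [->|n0]; first by split=> //; exists 0; rewrite mul0r.
  by split=> //; exists 1; rewrite mul1r.
have kQ : k%:~R != 0 :> rat by rewrite intr_eq0.
exists (\pi_QmodZ (k%:~R^-1)); last first.
  have [m ->] := nk; rewrite -raddfMz; apply/rat_integers_pi.
  by rewrite -mulrzr intrM mulrCA mulVf // mulr1; exact: intr_int.
apply/eqP => /rat_integers_pi/intrP[m] /(congr1 (fun x => x * k%:~R)).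
rewrite mulVf // -intrM => /esym/eqP.
rewrite -[1]/(1%:~R) eqr_int => /eqP/(congr1 absz); rewrite abszM => /eqP.
by rewrite muln_eq1 (negPf k1) andbF.
Qed.

(** Euclidean division by the least positive member; if there is none, the generator is 0. *)
Lemma subgroup_int_generator (I : int -> Prop) :
  I 0 -> (forall a b, I a -> I b -> I (a - b)) ->
  exists2 g, I g & forall a, I a -> exists m, a = m * g.
Proof.
move=> I0 IB.
have IN a : I a -> I (- a) by move=> Ia; rewrite -sub0r; apply: IB.
have ID a b : I a -> I b -> I (a + b) by move=> Ia Ib; rewrite -[b]opprK; apply/IB/IN.
have IMn a (n : nat) : I a -> I (a * n%:Z).
  move=> Ia; elim: n => [|n IHn]; first by rewrite mulr0.
  by rewrite -addn1 PoszD mulrDr mulr1; apply: ID.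
have IM m a : I a -> I (m * a).
  move=> Ia; rewrite mulrC; case: m => n; first exact: IMn.
  by rewrite NegzE mulrN; apply/IN/IMn.
have Iabs a : I a -> I `|a|%N%:Z.
  by move=> Ia; case: (intP a) Ia => // n Ia; rewrite abszN -[_%:Z]opprK; apply: IN.
case: (pselect (exists n : nat, (0 < n)%N && `[< I n%:Z >])) => [exI|noI]; last first.
  exists 0 => // a Ia; exists 0; rewrite mul0r; apply/eqP; apply: contrapT => /negP a0.
  by apply: noI; exists `|a|%N; rewrite absz_gt0 a0; apply/asboolP/Iabs.
case: (ex_minnP exI) => g /andP[g0 /asboolP Ig] gmin.
exists g%:Z => // a Ia; exists (a %/ g%:Z)%Z.
rewrite [LHS](divz_eq a g%:Z) -[RHS]addr0; congr (_ + _).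
have r0 : 0 <= (a %% g%:Z)%Z by rewrite modz_ge0 // -lt0n.
have rg : (a %% g%:Z)%Z < g%:Z by rewrite ltz_pmod // ltz_nat.
have Ir : I (a %% g%:Z)%Z.
  by rewrite /modz; apply: (IB) => //; apply: IM.
apply/eqP; apply: contrapT => /negP rn0.
have /gmin : (0 < `|(a %% g%:Z)%Z|)%N && `[< I `|(a %% g%:Z)%Z|%N%:Z >].
  by rewrite absz_gt0 rn0; apply/asboolP/Iabs.
by rewrite leqNgt -ltz_nat gez0_abs // rg.
Qed.

Section Characters.
Variable C : zmodType.
Implicit Types (G : set (C * QmodZ)) (c x : C) (q y : QmodZ).

(** The graph of a homomorphism from a subgroup of [C] to Q/Z. As graphs, extensions are inclusions
    and chains have unions, which suits Zorn's lemma. The empty set qualifies, hence the separate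
    hypothesis [G 0] below. *)
Definition partial_character G : Prop :=
  (forall a b, G a -> G b -> G (a - b)) /\ (forall q, G (0, q) -> q = 0).

Section PartialCharacterTheory.
Variables (G : set (C * QmodZ)) (pG : partial_character G).

Lemma partial_character0 a : G a -> G 0.
Proof. by move=> Ga; rewrite -(subrr a); apply: pG.1. Qed.

Lemma partial_characterN a : G a -> G (- a).
Proof. by move=> Ga; rewrite -sub0r; apply: pG.1 => //; apply: partial_character0 Ga. Qed.

Lemma partial_characterD a b : G a -> G b -> G (a + b).
Proof. by move=> Ga Gb; rewrite -[b]opprK; apply: pG.1 => //; apply: partial_characterN. Qed.

Lemma partial_characterMz a (n : int) : G a -> G (a *~ n).
Proof.
move=> Ga; have Gn (m : nat) : G (a *+ m).
  elim: m => [|m IHm]; first by rewrite mulr0n; apply: partial_character0 Ga.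
  by rewrite mulrS; apply: partial_characterD.
by case: n => m; rewrite /intmul; [apply: Gn | apply/partial_characterN/Gn].
Qed.

Lemma partial_character_fun x q q' : G (x, q) -> G (x, q') -> q = q'.
Proof.
move=> Gq Gq'; apply/eqP; rewrite -subr_eq0; apply/eqP/pG.2.
by rewrite -(subrr x); apply: (pG.1 _ _ Gq Gq').
Qed.

End PartialCharacterTheory.

(** The condition on [q] keeps the group generated by [G] and [(c, q)] single-valued: if
    [(x, y') + (c, q) *~ n] has first component 0, then [(c *~ n, - y')] lies in [G], so
    [- y' = q *~ n] and the second component is 0 as well. *)
Lemma partial_character_adjoin G c q : partial_character G -> G 0 ->
  (forall n y, G (c *~ n, y) -> y = q *~ n) ->
  exists G', [/\ partial_character G', G `<=` G' & G' (c, q)]%classic.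
Proof.
move=> pG G0 cq.
exists [set a | exists b n, G b /\ a = b + (c, q) *~ n]%classic; split.
- split=> [_ _ [b [n [Gb ->]]] [b' [n' [Gb' ->]]]|y [[x y'] [n [Gb]]]].
    exists (b - b'), (n - n'); split; first exact: pG.1.
    by rewrite mulrzBr addrACA opprD.
  have -> : (c, q) *~ n = (c *~ n, q *~ n).
    by rewrite [LHS]surjective_pairing !(raddfMz fst) !(raddfMz snd).
  move=> [x0 ->]; have : G (- (x, y')) by apply: partial_characterN.
  have -> : - (x, y') = (c *~ n, - y').
    by congr (_, _); apply/eqP; rewrite eq_sym -addr_eq0 addrC -x0.
  by move=> /cq <-; rewrite subrr.
- by move=> a Ga; exists a, 0; rewrite mulr0z addr0.
- by exists 0, 1; rewrite mulr1z add0r.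
Qed.

(** The integers [n] with [c *~ n] in the domain are the multiples of some [g], so only the value at
    [c *~ g] constrains [q]. Divisibility solves [q *~ g = y0]; when [g = 0] the value [y0] is 0 and
    [q = 0] serves. *)
Lemma partial_character_extend1 G c : partial_character G -> G 0 ->
  exists G', [/\ partial_character G', G `<=` G' & exists q, G' (c, q)]%classic.
Proof.
move=> pG G0.
have [||g [y0 Gg] gen] := @subgroup_int_generator (fun n => exists y, G (c *~ n, y)).
- by exists 0; rewrite mulr0z.
- move=> a b [y Gy] [y' Gy']; exists (y - y'); rewrite mulrzBr.
  exact: (pG.1 _ _ Gy Gy').
have [q qy0] : exists q, q *~ g = y0.
  case: (eqVneq g 0) => [g0|]; last exact: QmodZ_divisible.
  exists 0; rewrite mul0rz; apply/esym/pG.2.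
  by rewrite -(mulr0z c) -g0.
have [|G' [pG' GG' Gq]] := @partial_character_adjoin G c q pG G0; last first.
  by exists G'; split=> //; exists q.
move=> n y Gy; have [m nE] : exists m, n = m * g by apply: gen; exists y.
apply: (partial_character_fun pG Gy); rewrite nE mulrC !mulrzA qy0.
have := partial_characterMz pG m Gg.
by rewrite [X in G X]surjective_pairing (raddfMz fst) (raddfMz snd).
Qed.

(* Baer's criterion: a maximal partial character is total because Q/Z is
   divisible. *)
Theorem character_extend G : partial_character G -> G 0 ->
  exists f : character C, forall x y, G (x, y) -> character_fun f x = y.
Proof.
move=> pG G0.
(* The order is on sets [X] whose union with [G] is a partial character, not on those that contain
   [G]: the empty chain has empty union, which must qualify. *)
have [|M [pM Mmax]] := @Zorn_bigcup _ [set X | partial_character (G `|` X)]%classic.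
  move=> F FP Ftot; split=> [a b|q].
    move=> Ga Gb.
    have [X [[->|FX] [aX bX]]] : exists X, (X = set0 \/ F X) /\
        ((G `|` X) a /\ (G `|` X) b)%classic.
      case: Ga => [Ga|[X FX Xa]]; case: Gb => [Gb|[Y FY Yb]].
      - by exists set0; split; [left | split; left].
      - by exists Y; split; [right | split; [left | right]].
      - by exists X; split; [right | split; [right | left]].
      - case: (Ftot _ _ FX FY) => XY.
          by exists Y; split; [right | split; right=> //; apply: XY].
        by exists X; split; [right | split; right=> //; apply: XY].
    + left; rewrite setU0 in aX bX; exact: pG.1.
    + case: ((FP _ FX).1 _ _ aX bX) => [Gab|Xab]; first by left.
      by right; exists X.
  move=> [/pG.2 //|[X FX Xq]]; by apply: (FP _ FX).2; right.
set H := (G `|` M)%classic in pM.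
have H0 : H 0 by left.
have tot c : exists q, H (c, q).
  have [G' [pG' HG' [q Gq]]] := partial_character_extend1 c pM H0.
  exists q; apply: contrapT => nHq.
  apply: (Mmax G'); last first.
    rewrite /= (_ : (G `|` G')%classic = G') //; apply/seteqP; split=> [a [Ga|//]|a].
      by apply: HG'; left.
    by right.
  split; first by move=> a Ma; apply: HG'; right.
  by move=> G'M; apply: nHq; right; apply: G'M.
have [f fP] := choice tot.
have fB : zmod_morphism f.
  move=> x y; apply: (partial_character_fun pM (fP _)).
  exact: (pM.1 _ _ (fP x) (fP y)).
exists (Character (asboolT fB : (f : product _) \in @is_character C)) => x y Gxy.
by apply: (partial_character_fun pM (fP x)); left.
Qed.

End Characters.

(** Let [g] generate the integers [n] with [z *~ n] in [I]. As [z] is not in [I], [g] is neither 1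
    nor -1, so some nonzero [q] is killed by [g]; the character that is 0 on [I] and [q] at [z] is
    then well defined and extends to [B]. *)
Lemma character_separates (B : zmodType) (I : zmodClosed B) z : z \notin I ->
  exists2 f : character B,
    (forall x, x \in I -> character_fun f x = 0) & character_fun f z != 0.
Proof.
move=> zI.
have [||g Ig gen] := @subgroup_int_generator (fun n => z *~ n \in I).
- by rewrite mulr0z rpred0.
- by move=> a b Ia Ib; rewrite mulrzBr rpredB.
have [|q q0 qg] := @QmodZ_torsion g.
  apply: contra zI => /eqP; case: (intP g) Ig => // n; rewrite ?mulrNz ?rpredN => In.
    by move=> [n1]; rewrite n1 in In.
  by rewrite abszN => -[n1]; rewrite n1 in In.
set G := [set a : B * QmodZ | a.1 \in I /\ a.2 = 0]%classic.
have [||//|G' [pG' GG' Gq]] := @partial_character_adjoin _ G z q.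
- split=> [a b [aI a0] [bI b0]|y [_ //]].
  by split=> /=; rewrite ?rpredB // a0 b0 subrr.
- by split=> //=; rewrite rpred0.
- move=> n y [/= /gen[m ->] ->].
  by rewrite mulrC mulrzA qg mul0rz.
have [|f fP] := character_extend pG'; first by apply: GG'; split=> //=; rewrite rpred0.
exists f => [x xI|]; last by rewrite (fP _ _ Gq).
by apply: fP; apply: GG'.
Qed.

(** Injectivity of Q/Z: [f] descends to the image of [g], where its graph is the set of pairs
    [(g x, f x)], and is extended from there. *)
Lemma character_factor (B C : zmodType) (g : {additive B -> C}) (f : character B) :
  (forall x, g x = 0 -> character_fun f x = 0) ->
  exists h : character C, forall x, character_fun h (g x) = character_fun f x.
Proof.
move=> fg.
have [||h hP] := @character_extend _
    [set a | exists x, a = (g x, character_fun f x)]%classic.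
- split=> [_ _ [x ->] [y ->]|q [x [/esym/fg fx ->] //]].
  by exists (x - y); rewrite !raddfB.
- by exists 0; rewrite !raddf0.
by exists h => x; apply: hP; exists x.
Qed.

Lemma homology_trivialP (A B C : zmodType) (f : {additive A -> B}) (g : {additive B -> C}) :
  trivial_group (homology f g) <-> (forall x, g x = 0 -> exists y, f y = x).
Proof.
split=> [H x gx|H].
  have xK : x \in additive_kernel g by apply/eqP.
  by have /quot_pi_eq0/asboolP := H (\pi_(homology f g) (Cycle xK)).
elim/quotW => -[x xK]; apply/quot_pi_eq0/asboolP.
exact/H/eqP.
Qed.

(* Q/Z is an injective cogenerator, so a sequence is exact iff its sequence of
   characters, here identified with H0 -> H1 -> H2 by the bijections phi, is. *)
Lemma homology_character (T0 T1 T2 H0 H1 H2 : zmodType)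
    (d1 : {additive T2 -> T1}) (d0 : {additive T1 -> T0})
    (e0 : {additive H0 -> H1}) (e1 : {additive H1 -> H2})
    (phi0 : character T0 -> H0) (phi1 : character T1 -> H1) (phi2 : character T2 -> H2) :
  (forall f, phi1 (character_comp d0 f) = e0 (phi0 f)) ->
  (forall f, phi2 (character_comp d1 f) = e1 (phi1 f)) ->
  injective phi1 -> injective phi2 -> phi2 0 = 0 ->
  (forall h, exists f, phi0 f = h) -> (forall h, exists f, phi1 f = h) ->
  trivial_group (homology d1 d0) <-> trivial_group (homology e0 e1).
Proof.
move=> E0 E1 I1 I2 Z2 S0 S1; rewrite !homology_trivialP; split=> H h.
  have [f <-] := S1 h; rewrite -E1 -Z2 => /I2 fd.
  have [|k kP] := @character_factor _ _ d0 f.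
    by move=> x /H[y <-]; have := congr1 (fun h : character T2 => character_fun h y) fd.
  by exists (phi0 k); rewrite -E0; congr phi1; apply: character_ext.
(* Conversely, a cycle [h] that is not a boundary is detected by a character vanishing on
   boundaries. By exactness this character is pulled back along [d0], so it vanishes at [h], a
   contradiction. *)
move=> dh; apply: contrapT => nh.
have [|f fI fh] := @character_separates _ (additive_image d1) h.
  by apply/asboolPn.
have [|k kP] := H (phi1 f).
  rewrite -E1 -Z2; congr phi2; apply: character_ext => x.
  by apply: fI; apply/asboolP; exists x.
have [k' k'P] := S0 k; move: kP fh; rewrite -k'P -E0 => /I1 <-.
by rewrite [character_fun _ _](congr1 (character_fun k') dh) raddf0 eqxx.
Qed.

Definition character_of (M : zmodType) (f : {additive M -> QmodZ}) : character M :=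
  Character (asboolT (raddfB f) : (f : product (fun _ : M => QmodZ)) \in @is_character M).

Lemma character_ofE (M : zmodType) (f : {additive M -> QmodZ}) x :
  character_fun (character_of f) x = f x.
Proof. by []. Qed.

(** * Characters of direct sums *)

Section DirectSumInclusion.
Variables (I : choiceType) (A : I -> zmodType).

Definition dsum_in_fun i (x : A i) : product A := fun j =>
  if pselect (i = j) is left e then eq_rect i (fun k => A k) x j e else 0.

Lemma dsum_in_fun_id i (x : A i) : dsum_in_fun x i = x.
Proof.
by rewrite /dsum_in_fun; case: pselect => // e; rewrite (Prop_irrelevance e erefl).
Qed.

Lemma dsum_in_fun_neq i (x : A i) j : i <> j -> dsum_in_fun x j = 0.
Proof. by rewrite /dsum_in_fun; case: pselect. Qed.

Fact dsum_in_subproof i (x : A i) : dsum_in_fun x \in @Defs.finite_support I A.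
Proof.
apply/asboolP; apply: (@sub_finite_set _ _ [set i]%classic) => // j /= /eqP xj.
by apply: contrapT => ij; apply: xj; apply: dsum_in_fun_neq => /esym.
Qed.

Definition dsum_in i (x : A i) : direct_sum A := DirectSum (dsum_in_subproof x).

Lemma dsum_in_id i (x : A i) : dsum_val (dsum_in x) i = x.
Proof. exact: dsum_in_fun_id. Qed.

Lemma dsum_in_neq i (x : A i) j : i <> j -> dsum_val (dsum_in x) j = 0.
Proof. exact: dsum_in_fun_neq. Qed.

Fact dsum_in_is_zmod_morphism i : zmod_morphism (@dsum_in i).
Proof.
move=> x y; apply: dsum_ext => j; rewrite dsum_valD dsum_valN.
case: (pselect (i = j)) => [ij|ij]; last by rewrite !dsum_in_neq // subrr.
by case: _ / ij; rewrite !dsum_in_id.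
Qed.

HB.instance Definition _ i :=
  GRing.isZmodMorphism.Build (A i) (direct_sum A) (@dsum_in i)
    (@dsum_in_is_zmod_morphism i).

Lemma dsum_ind (P : direct_sum A -> Prop) :
  P 0 -> (forall i (x : A i) t, P t -> P (t + dsum_in x)) -> forall t, P t.
Proof.
move=> P0 PD t; have /asboolP/finite_seqP[s sP] := dsum_valP t.
have {sP} : forall i, dsum_val t i != 0 -> i \in s.
  by move=> i ti; have : [set` s]%classic i by rewrite -sP.
elim: s t => [|i s IHs] t ts.
  suff -> : t = 0 by [].
  by apply: dsum_ext => i; apply/eqP; apply: contraT => /ts.
rewrite -(subrK (dsum_in (dsum_val t i)) t); apply/PD/IHs => j.
rewrite dsum_valD dsum_valN.
case: (pselect (i = j)) => [<-|ij]; first by rewrite dsum_in_id subrr eqxx.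
by rewrite dsum_in_neq // subr0 => /ts; rewrite in_cons => /orP[/eqP/esym|].
Qed.

Lemma dsum_character (f : forall i, character (A i)) :
  exists g : character (direct_sum A),
    forall i (x : A i), character_fun g (dsum_in x) = character_fun (f i) x.
Proof.
pose g (t : direct_sum A) := \sum_(i \in [set: I]) character_fun (f i) (dsum_val t i).
(* The sum may be computed over any finite set containing the support; additivity then uses the
   union of the two supports. *)
have gE (t : direct_sum A) (S : {fset I}) : (forall i, i \notin S -> dsum_val t i = 0) ->
    g t = \sum_(i <- S) character_fun (f i) (dsum_val t i).
  by move=> tS; apply: fsbigTE => i /tS ->; rewrite raddf0.
have supp (t : direct_sum A) : exists S : {fset I}, forall i, i \notin S -> dsum_val t i = 0.
  have /asboolP/finite_fsetP[S SP] := dsum_valP t; exists S => i iS.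
  apply/eqP; apply: contraNT iS => ti.
  by have : [set` S]%classic i by rewrite -SP.
have gD : {morph g : t u / t + u}.
  move=> t u; have [[S tS] [S' uS']] := (supp t, supp u).
  have St i : i \notin (S `|` S')%fset -> dsum_val t i = 0.
    by rewrite inE => /norP[/tS].
  have Su i : i \notin (S `|` S')%fset -> dsum_val u i = 0.
    by rewrite inE => /norP[_ /uS'].
  rewrite (gE t _ St) (gE u _ Su) (gE (t + u) (S `|` S')%fset); last first.
    by move=> i iS; rewrite dsum_valD St // Su // addr0.
  by rewrite -big_split; apply: eq_bigr => i _; rewrite dsum_valD raddfD.
have g0 : g 0 = 0 by apply: (addrI (g 0)); rewrite -gD !addr0.
have gB : zmod_morphism g.
  by move=> t u; apply: (addIr (g u)); rewrite -gD !subrK.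
exists (Character (asboolT gB : (g : product _) \in @is_character (direct_sum A))).
move=> i x; rewrite /character_fun /=.
rewrite /g (fsbigTE [fset i]%fset) => [|j]; last first.
  rewrite inE => /eqP ji; rewrite dsum_in_neq ?raddf0 // => ij; exact: ji.
by rewrite big_seq_fset1 dsum_in_id.
Qed.

End DirectSumInclusion.

Section DirectSumMapInclusion.
Variables (I J : choiceType) (A : I -> zmodType) (B : J -> zmodType).
Variables (s : J -> I) (s_inj : injective s).
Variable f : forall j, {additive A (s j) -> B j}.

Lemma dsum_map_in j (x : A (s j)) : dsum_map s_inj f (dsum_in x) = dsum_in (f j x).
Proof.
apply: dsum_ext => k.
change (f k (dsum_val (dsum_in x) (s k)) = dsum_val (dsum_in (f j x)) k).
case: (pselect (j = k)) => [<-|jk]; first by rewrite !dsum_in_id.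
by rewrite !dsum_in_neq ?raddf0 // => /s_inj.
Qed.

End DirectSumMapInclusion.

(** * Characters of the modified tensor product as balanced pairings *)

HB.instance Definition _ n := gen_eqMixin (bidegree n).
HB.instance Definition _ n := gen_choiceMixin (bidegree n).

(* The signs turning the relation f (dx, y) + (-1)^|x| f (x, dy) = 0, which
   characterises the characters of the modified tensor product, into
   b (dx, y) = b (x, dy). *)
Definition half_sign (i : int) : int := koszul_sign (i %/ 2)%Z.

Lemma koszul_sign_sqr i : koszul_sign i * koszul_sign i = 1.
Proof. by rewrite /koszul_sign -expr2 sqrr_sign. Qed.

Lemma half_sign_sqr i : half_sign i * half_sign i = 1.
Proof. exact: koszul_sign_sqr. Qed.

(** This recursion is what the sign has to satisfy: the relation reads
    [f (dx, y) = (-1)^i f (x, dy)] for [x] of degree [i + 1]. The solution (-1)^floor(i/2) runs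
    through +, +, -, - with period 4. *)
Lemma half_signS i : half_sign (i + 1) = koszul_sign i * half_sign i.
Proof.
have k2 (a : int) : koszul_sign (a * 2) = 1.
  by rewrite /koszul_sign abszM exprM sqrr_sign.
rewrite /half_sign; have := divz_eq i 2; set q := (i %/ 2)%Z => iE.
have : (i %% 2)%Z = 0 \/ (i %% 2)%Z = 1.
  have := modz_ge0 i (isT : 2 != 0 :> int); have := ltz_pmod i (isT : 0 < 2 :> int).
  by case: (i %% 2)%Z => // -[|[|k]] //; [left|right].
case=> r; rewrite iE r.
  by rewrite addr0 k2 mul1r; congr koszul_sign; rewrite divzMDl // addr0.
by rewrite koszul_signS k2 -addrA divzMDl // koszul_signS mulN1r.
Qed.

Section BarPairing.
Variables (R : pzRingType) (X : chain_complex R^c) (Y : chain_complex R) (n : int).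

Definition bar_tens (i j : int) (ij : i + j == n) (x : X i) (y : Y j) : bar_degree X Y n :=
  \pi_(bar_degree X Y n)
    (dsum_in (A := @tensor_term R X Y n) (i := Bidegree ij) (tens x y)).

(** As in [cdiff], [i'] and [j'] are variables tied by equations, so that the condition applies in
    degrees such as [s m] and [- k] without transport. *)
Definition bar_pairing (b : forall i j : int, i + j == n -> X i -> Y j -> QmodZ) : Prop :=
  (forall (i j : int) ij, balanced (b i j ij)) /\
  (forall (i i' j j' : int) (ii' : i' = i + 1) (jj' : j' = j + 1)
      (ij1 : i + j' == n) (ij2 : i' + j == n) x y,
    b i j' ij1 (cdiff X ii' x) y = b i' j ij2 x (cdiff Y jj' y)).

Lemma tensor_d_in (i j : int) (ij1 : i + (j + 1) == n) (ij2 : i + 1 + j == n)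
    (ij : i + 1 + (j + 1) == n + 1) (x : X (i + 1)) (y : Y (j + 1)) :
  tensor_d X Y (erefl (n + 1))
    (dsum_in (A := @tensor_term R X Y (n + 1)) (i := Bidegree ij) (tens x y)) =
  dsum_in (A := @tensor_term R X Y n) (i := Bidegree ij1)
    (tens (cdiff X (erefl (i + 1)) x) y) +
  dsum_in (A := @tensor_term R X Y n) (i := Bidegree ij2)
    (tens x (cdiff Y (erefl (j + 1)) y)) *~ koszul_sign (i + 1).
Proof.
rewrite /tensor_d /=; congr (_ + _).
  rewrite (bool_irrelevance ij (shiftl_subproof (erefl (n + 1)) (Bidegree ij1))).
  rewrite -[tens (cdiff _ _ x) y](tensor_mapE (cdiff X (erefl (i + 1))) idfun).
  exact: (@dsum_map_in _ _ (@tensor_term R X Y (n + 1)) (@tensor_term R X Y n)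
    _ (@shiftl_inj _ n erefl)
    (fun p => tensor_map (cdiff X (erefl (deg1 p + 1))) idfun) (Bidegree ij1)).
rewrite (bool_irrelevance ij (shiftr_subproof (erefl (n + 1)) (Bidegree ij2))).
rewrite -raddfMz -[tens x (cdiff _ _ y)](tensor_mapE idfun (cdiff Y (erefl (j + 1)))).
exact: (@dsum_map_in _ _ (@tensor_term R X Y (n + 1)) (@tensor_term R X Y n)
  _ (@shiftr_inj _ n erefl) (fun p => koszul_map (deg1 p)
    (tensor_map idfun (cdiff Y (erefl (deg2 p + 1))))) (Bidegree ij2)).
Qed.

Lemma bar_tens_balanced (i j : int) (ij : i + j == n) : balanced (@bar_tens i j ij).
Proof.
have [bl br bs] := @tens_balanced R (X i) (Y j).
by split=> *; rewrite /bar_tens ?bl ?br ?bs // !raddfD.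
Qed.

Lemma bar_tens_d (i j : int) (ij1 : i + (j + 1) == n) (ij2 : i + 1 + j == n) x y :
  bar_tens ij1 (cdiff X (erefl (i + 1)) x) y +
  bar_tens ij2 x (cdiff Y (erefl (j + 1)) y) *~ koszul_sign (i + 1) = 0.
Proof.
have ij : i + 1 + (j + 1) == n + 1 by rewrite addrA (eqP ij2).
rewrite /bar_tens -raddfMz -raddfD -(tensor_d_in _ _ ij).
apply/quot_pi_eq0/asboolP.
by exists (dsum_in (A := @tensor_term R X Y (n + 1)) (i := Bidegree ij) (tens x y)).
Qed.

Lemma tensor_degree_ext (A : zmodType) m (f g : {additive tensor_degree X Y m -> A}) :
  (forall (i j : int) (ij : i + j == m) (x : X i) (y : Y j),
    f (dsum_in (A := @tensor_term R X Y m) (i := Bidegree ij) (tens x y)) =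
    g (dsum_in (A := @tensor_term R X Y m) (i := Bidegree ij) (tens x y))) ->
  f =1 g.
Proof.
move=> fg; apply: dsum_ind => [|[i j ij] t u IH]; first by rewrite !raddf0.
rewrite !raddfD IH; congr (_ + _).
apply: (@tensor_ext _ _ _ _ (f \o dsum_in (A := @tensor_term R X Y m) (i := Bidegree ij))
  (g \o dsum_in (A := @tensor_term R X Y m) (i := Bidegree ij))) => x y.
exact: fg.
Qed.

Lemma bar_character_ext (f g : character (bar_degree X Y n)) :
  (forall (i j : int) (ij : i + j == n) x y,
    character_fun f (bar_tens ij x y) = character_fun g (bar_tens ij x y)) -> f = g.
Proof.
move=> fg; apply: character_ext; elim/quotW.
exact: (@tensor_degree_ext _ _ (character_fun f \o \pi_(bar_degree X Y n))
  (character_fun g \o \pi_(bar_degree X Y n))).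
Qed.

Lemma pairing_of_character (f : character (bar_degree X Y n)) :
  bar_pairing (fun i j ij x y => character_fun f (bar_tens ij x y) *~ half_sign i).
Proof.
split=> [i j ij|i i' j j' ii' jj'].
  have [bl br bs] := bar_tens_balanced ij.
  by split=> *; rewrite ?bl ?br ?bs // raddfD mulrzDl.
subst i' j'; move=> ij1 ij2 x y; have /eqP := bar_tens_d ij1 ij2 x y.
rewrite addr_eq0 => /eqP ->; rewrite raddfN raddfMz koszul_signS mulrNz opprK.
by rewrite -mulrzA half_signS.
Qed.

(** Inverse to [pairing_of_character], with the same factor since [half_sign] squares to 1. The
    pairing gives a character of each summand; the glued character kills boundaries by the Leibniz
    rule [tensor_d_in]. *)
Lemma character_of_pairing b : bar_pairing b ->
  exists f : character (bar_degree X Y n), forall (i j : int) (ij : i + j == n) x y,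
    character_fun f (bar_tens ij x y) = b i j ij x y *~ half_sign i.
Proof.
move=> [bB bd].
have bsB i j (ij : i + j == n) : balanced (fun x y => b i j ij x y *~ half_sign i).
  have [bl br bs] := bB i j ij.
  by split=> *; rewrite ?bl ?br ?bs // mulrzDl.
pose g (p : bidegree n) : character (@tensor_term R X Y n p) :=
  character_of (tensor_lift (bsB _ _ (bidegreeP p))).
have [h hP] := dsum_character g.
have hE i j (ij : i + j == n) (x : X i) (y : Y j) : character_fun h
    (dsum_in (A := @tensor_term R X Y n) (i := Bidegree ij) (tens x y)) =
    b i j ij x y *~ half_sign i.
  by rewrite hP character_ofE tensor_liftE.
have hd t : character_fun h (tensor_d X Y (erefl (n + 1)) t) = 0.
  apply: (@tensor_degree_ext _ _ (character_fun h \o tensor_d X Y (erefl (n + 1)))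
    (\0 : {additive _ -> _})) => i' j' ij.
  (* In [int] every degree is a successor, so each elementary tensor has the form that [tensor_d_in]
     requires. *)
  have [i ii'] : exists i, i + 1 = i' by exists (i' - 1); rewrite subrK.
  have [j jj'] : exists j, j + 1 = j' by exists (j' - 1); rewrite subrK.
  case: _ / ii' ij; case: _ / jj' => ij x y.
  have ij2 : i + 1 + j == n by move: ij; rewrite addrA (inj_eq (addIr _)).
  have ij1 : i + (j + 1) == n by rewrite addrCA addrC.
  rewrite [LHS](congr1 (character_fun h) (tensor_d_in ij1 ij2 ij x y)) raddfD raddfMz /= !hE.
  rewrite (bd _ _ _ _ erefl erefl ij1 ij2) -mulrzA half_signS koszul_signS mulrN mulrAC.
  by rewrite koszul_sign_sqr mul1r mulrNz subrr.
pose q := quot_lift (I := boundaries (tensor_complex X Y) n) (f := character_fun h).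
have hI t : t \in boundaries (tensor_complex X Y) n -> character_fun h t = 0.
  by move=> /asboolP[u <-]; apply: hd.
exists (character_of (q hI)) => i j ij x y.
by rewrite character_ofE [LHS]quot_liftE; apply: hE.
Qed.

End BarPairing.

(** * Transport between degrees, shifts of complexes and of resolutions *)

Section ComplexBasics.
Variable R : pzRingType.
Implicit Types X Y Z : chain_complex R.

Lemma chain_map_ext X Y (f g : chain_map X Y) :
  (forall n x, cmap f n x = cmap g n x) -> f = g.
Proof.
move=> fg; apply/val_inj; do 2 apply: functional_extensionality_dep => ?.
exact: fg.
Qed.

Definition mk_chain_map X Y (f : forall n, X n -> Y n) (fP : is_chain_map f) :
  chain_map X Y := ChainMap (asboolT fP : (f : degree_map X Y) \in @chain_map_pred R X Y).

Definition ccast X (i j : int) (ij : i = j) (x : X i) : X j :=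
  eq_rect i (fun k => X k) x j ij.

Lemma ccast_id X i (ii : i = i) (x : X i) : ccast ii x = x.
Proof. by rewrite (eq_irrelevance ii erefl). Qed.

Fact ccast_is_linear X i j (ij : i = j) : linear (@ccast X i j ij).
Proof. by case: _ / ij. Qed.

HB.instance Definition _ X i j ij :=
  GRing.isLinear.Build R (X i) (X j) _ (@ccast X i j ij) (@ccast_is_linear X i j ij).

Lemma cmap_ccast X Y (f : chain_map X Y) i j (ij : i = j) x :
  cmap f j (ccast ij x) = ccast ij (cmap f i x).
Proof. by case: _ / ij. Qed.

Lemma ccast_comp X i j k (ij : i = j) (jk : j = k) (ik : i = k) (x : X i) :
  ccast jk (ccast ij x) = ccast ik x.
Proof. by case: _ / jk ik; case: _ / ij => ik; rewrite !ccast_id. Qed.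

Lemma cdiff_ccast X m m' n n' (mm' : m = m') (nn' : n = n') (mn : m = n + 1)
    (mn' : m' = n' + 1) (x : X m) :
  cdiff X mn' (ccast mm' x) = ccast nn' (cdiff X mn x).
Proof.
case: _ / mm' mn'; case: _ / nn' => mn'.
by rewrite !ccast_id (eq_irrelevance mn mn').
Qed.

End ComplexBasics.

(* Translation by c, indexed by any s with s i = i + c so that s may be the
   identity, for which no transport between X i and X (i + 0) is needed. *)
Section Shift.
Variables (R : pzRingType) (s : int -> int) (c : int) (sE : forall i, s i = i + c).
Implicit Types X Y Z : chain_complex R.

Lemma shift_degree m n : m = n + 1 -> s m = s n + 1.
Proof. by rewrite !sE => ->; rewrite addrAC. Qed.

Fact shift_subproof X l m n (lm : l = m + 1) (mn : m = n + 1) (x : X (s l)) :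
  cdiff X (shift_degree mn) (cdiff X (shift_degree lm) x) = 0.
Proof. exact: cdiffK. Qed.

Definition shift X : chain_complex R :=
  ChainComplex (cobj := fun n => X (s n))
    (cdiff := fun m n mn => cdiff X (shift_degree mn)) (@shift_subproof X).

Fact shift_map_subproof X Y (f : chain_map X Y) :
  @is_chain_map R (shift X) (shift Y) (fun n => cmap f (s n)).
Proof.
by split=> [n a x y|m n mn x]; [exact: (linearP (cmap f (s n)))|];
  exact: (cmapE f (shift_degree mn)).
Qed.

Definition shift_map X Y (f : chain_map X Y) : chain_map (shift X) (shift Y) :=
  mk_chain_map (shift_map_subproof f).

End Shift.

Section ShiftResolution.
Variables (R : pzRingType) (s : int -> int) (c : int) (sE : forall i, s i = i + c).
Implicit Types X Y Z P : chain_complex R.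
Local Notation sh := (shift sE).
Let tE : forall i, i - c = i + - c. Proof. by []. Qed.
Let stK i : s (i - c) = i. Proof. by rewrite sE subrK. Qed.
Let tsK i : s i - c = i. Proof. by rewrite sE addrK. Qed.

(** The lifting problem is shifted back by [c], solved for [P] and shifted forward. The two shifts
    cancel only up to the equations [stK] and [tsK], hence the casts. *)
Lemma shift_projective P : projective P -> projective (sh P).
Proof.
move=> Pproj Y Z g f gepi.
have f'P : @is_chain_map R P (shift tE Z)
    (fun i x => cmap f (i - c) (ccast (esym (stK i)) x)).
  split=> [n a x y|m n mn x]; first by rewrite !linearP.
  have E := cdiff_ccast (esym (stK m)) (esym (stK n)) mn
    (shift_degree sE (shift_degree tE mn)) x.
  exact: (etrans (congr1 (cmap f (n - c)) (esym E)) (cmapE f (shift_degree tE mn) _)).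
have [|h hP] := Pproj _ _ (shift_map tE g) (mk_chain_map f'P).
  by move=> n y; apply: gepi.
have h'P : @is_chain_map R (sh P) Y (fun i x => ccast (tsK i) (cmap h (s i) x)).
  split=> [n a x y|m n mn x]; first by rewrite !linearP.
  rewrite cmapE; apply/esym; exact: cdiff_ccast.
exists (mk_chain_map h'P); apply: chain_map_ext => n x.
change (cmap g n (ccast (tsK n) (cmap h (s n) x)) = cmap f n x).
rewrite cmap_ccast.
have -> : cmap g (s n - c) (cmap h (s n) x) = cmap (precomp h (shift_map tE g)) (s n) x.
  by [].
rewrite hP.
change (ccast (tsK n) (cmap f (s n - c) (ccast (esym (stK (s n))) x)) = cmap f n x).
rewrite -cmap_ccast; congr (cmap f n _).
have castE i j (ij : i = j) (y : sh P i) : ccast ij y = ccast (X := P) (congr1 s ij) y.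
  by case: _ / ij; rewrite !ccast_id.
by rewrite castE (ccast_comp _ _ erefl) ccast_id.
Qed.

Section Resolution.
Variables (X : chain_complex R) (P : projective_resolution X).

(** Closed by [Defined] because its terms and differentials must compute to the shifts of those of
    [P] when Tor is compared with Ext. *)
Definition shift_resolution : projective_resolution (sh X).
Proof.
apply: (@ProjectiveResolution R (sh X) (fun k => sh (P k))
  (fun k => shift_map sE (res_diff P k)) (shift_map sE (res_aug P))).
- by move=> k; apply/shift_projective/res_projective.
- by move=> n y; apply: res_aug_epi.
- by move=> n x; exact: (@res_exact0 _ _ P (s n) x).
- by move=> k n x; exact: (@res_exactS _ _ P k (s n) x).
Defined.

End Resolution.

Lemma shift_fg X : fg_complex X -> fg_complex (sh X).
Proof.
move=> [[N XN] Xfg]; split=> [|n]; last exact: Xfg.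
exists (N + `|c|) => n nN; apply: XN; rewrite sE.
rewrite -(ltrD2r `|c|) (lt_le_trans nN) //.
by rewrite -[n in leLHS](addrK c) -[X in _ <= _ + X]normrN ler_normD.
Qed.

Lemma shift_FP X : FP_infinity X -> FP_infinity (sh X).
Proof. by move=> [P Pfg]; exists (shift_resolution P) => k; apply/shift_fg. Qed.

End ShiftResolution.

(** * The adjunction between the modified tensor product and the dual complex *)

Lemma bar_tensor_map_tens (R : pzRingType) (X X' : chain_complex R^c)
    (Y Y' : chain_complex R) (f : chain_map X X') (g : chain_map Y Y') n i j
    (ij : i + j == n) x y :
  cmap (bar_tensor_map f g) n (bar_tens ij x y) = bar_tens ij (cmap f i x) (cmap g j y).
Proof.
change (bar_tensor_degree_map f g n (bar_tens ij x y)
  = bar_tens ij (cmap f i x) (cmap g j y)).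
rewrite /bar_tensor_degree_map /bar_tens quot_mapE; congr (\pi _).
rewrite /tensor_degree_map -(tensor_mapE (cmap f i) (cmap g j)).
exact: (@dsum_map_in _ _ (@tensor_term R X Y n) (@tensor_term R X' Y' n)
  _ (@inj_id (bidegree n))
  (fun p => tensor_map (cmap f (deg1 p)) (cmap g (deg2 p))) (Bidegree ij)).
Qed.

Section LeftDualPairing.
Variables (R : pzRingType) (L : chain_complex R) (s : int -> int) (n : int).
Hypothesis sE : forall i, s i = i + n.
Implicit Types P Q : chain_complex R^c.

Let deg i : s i + - i == n. Proof. by rewrite sE addrAC subrr add0r. Qed.

Let deg_inv i j : i + j == n -> exists2 k, s k = i & - k = j.
Proof.
move=> ij; exists (i - n); first by rewrite sE subrK.
by rewrite -(eqP ij) opprB addrAC subrr add0r.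
Qed.

Fact left_adjoint_char_subproof P (f : character (bar_degree P L n)) i (x : P (s i)) :
  ((fun y => character_fun f (bar_tens (deg i) x y) *~ half_sign (s i)) :
    product (fun _ : L (- i) => QmodZ)) \in @is_character (L (- i)).
Proof.
have [_ br _] := (pairing_of_character f).1 _ _ (deg i).
apply/asboolP => y z.
apply: (addIr (character_fun f (bar_tens (deg i) x z) *~ half_sign (s i))).
by rewrite -br !subrK.
Qed.

Definition left_adjoint_char P f i x : left_character (L (- i)) :=
  Character (@left_adjoint_char_subproof P f i x).

(** Balancedness gives linearity in [x]. Commutation with the differentials is the relation of
    [bar_pairing] as it stands: the dual differential carries no sign, which is why the sign was
    removed from the pairing. *)
Fact left_adjoint_subproof P f :
  @is_chain_map _ (shift sE P) (left_dual L) (@left_adjoint_char P f).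
Proof.
have [bB bd] := pairing_of_character f; split=> [i r x x'|m k mk x].
  have [bl _ bs] := bB _ _ (deg i).
  apply: character_ext => y; apply: etrans (bl _ _ _) _.
  by congr (_ + _); apply: bs.
apply: character_ext => y.
exact: (bd _ _ _ _ (shift_degree sE mk) (dual_degree mk) (deg k) (deg m)).
Qed.

Definition left_adjoint P f : chain_map (shift sE P) (left_dual L) :=
  mk_chain_map (@left_adjoint_subproof P f).

Lemma left_adjointE P f i x y :
  character_fun (cmap (@left_adjoint P f) i x) y =
  character_fun f (bar_tens (deg i) x y) *~ half_sign (s i).
Proof. by []. Qed.

Lemma left_adjoint0 P : @left_adjoint P 0 = 0.
Proof.
apply: chain_map_ext => i x; apply: character_ext => y.
by rewrite left_adjointE; apply: mul0rz.
Qed.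

Lemma left_adjoint_inj P : injective (@left_adjoint P).
Proof.
move=> f g fg; apply: bar_character_ext => i j ij x y.
have [k ki kj] := deg_inv ij.
case: _ / ki ij x; case: _ / kj y => y ij x; rewrite (bool_irrelevance ij (deg k)).
have : cmap (left_adjoint f) k x = cmap (left_adjoint g) k x by rewrite fg.
move=> /(congr1 (fun h => character_fun h y *~ half_sign (s k))).
by rewrite !left_adjointE -!mulrzA half_sign_sqr.
Qed.

Lemma left_adjoint_surj P (g : chain_map (shift sE P) (left_dual L)) :
  exists f, left_adjoint f = g.
Proof.
have e1 i : i = s (i - n) by rewrite sE subrK.
have e2 i j (ij : i + j == n) : j = - (i - n).
  by rewrite -(eqP ij) opprB addrAC subrr add0r.
pose b i j (ij : i + j == n) (x : P i) (y : L j) : QmodZ :=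
  character_fun (cmap g (i - n) (ccast (e1 i) x)) (ccast (e2 i j ij) y).
(* At indices [s k] and [- k] the transports in [b] disappear; [deg_inv] brings every pair of
   degrees of sum [n] to this form. *)
have bE k (ij : s k + - k == n) (x : P (s k)) (y : L (- k)) :
    b _ _ ij x y = character_fun (cmap g k x) y.
  rewrite /b; move: (e1 (s k)) (e2 (s k) (- k) ij).
  have -> : s k - n = k by rewrite sE addrK.
  by move=> e e'; rewrite !ccast_id.
have [|f fP] := @character_of_pairing _ P L n b.
  split=> [i j ij|i i' j j' ii' jj' ij1 ij2 x y].
    split=> [x x' y|x y y'|r x y]; rewrite /b.
    - by rewrite !linearD.
    - by rewrite !linearD raddfD.
    - by rewrite !linearZ.
  have [k ki kj] := deg_inv ij1; have [k' ki' kj'] := deg_inv ij2.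
  case: _ / ki ii' ij1; case: _ / ki' ij2 x => ij2 x ii'.
  case: _ / kj jj' y; case: _ / kj' ij2 => ij2 jj' y ij1.
  have mk : k' = k + 1 by apply: (addIr n); rewrite -sE ii' sE addrAC.
  rewrite !bE (eq_irrelevance ii' (shift_degree sE mk)).
  rewrite (eq_irrelevance jj' (dual_degree mk)).
  exact: (congr1 (fun h => character_fun h y) (cmapE g mk x)).
exists f; apply: chain_map_ext => k x; apply: character_ext => y.
by rewrite left_adjointE fP bE -mulrzA half_sign_sqr.
Qed.

Lemma left_adjoint_precomp P Q (h : chain_map P Q) (f : character (bar_degree Q L n)) :
  left_adjoint (character_comp (cmap (bar_tensor_map h (chain_id L)) n) f) =
  precomp (shift_map sE h) (left_adjoint f).
Proof.
apply: chain_map_ext => i x; apply: character_ext => y.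
rewrite left_adjointE.
change (character_fun f (cmap (bar_tensor_map h (chain_id L)) n (bar_tens (deg i) x y))
    *~ half_sign (s i) =
  character_fun f (bar_tens (deg i) (cmap h (s i) x) y) *~ half_sign (s i)).
by rewrite bar_tensor_map_tens.
Qed.

Lemma barTor1l_Ext1 X (P : projective_resolution X) :
  trivial_group (barTor1l L P n) <->
  trivial_group (Ext1 (shift_resolution sE P) (left_dual L)).
Proof.
apply: (@homology_character _ _ _ _ _ _ _ _ _ _ (@left_adjoint (P 0%N))
  (@left_adjoint (P 1%N)) (@left_adjoint (P 2%N))).
- by move=> f; apply: left_adjoint_precomp.
- by move=> f; apply: left_adjoint_precomp.
- exact: left_adjoint_inj.
- exact: left_adjoint_inj.
- exact: left_adjoint0.
- exact: left_adjoint_surj.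
- exact: left_adjoint_surj.
Qed.

End LeftDualPairing.
Section RightDualPairing.
Variables (R : pzRingType) (L : chain_complex R^c) (s : int -> int) (n : int).
Hypothesis sE : forall i, s i = i + n.
Implicit Types P Q : chain_complex R.

Let deg i : - i + s i == n. Proof. by rewrite sE addKr. Qed.

Let deg_inv i j : i + j == n -> exists2 k, s k = j & - k = i.
Proof.
move=> ij; exists (j - n); first by rewrite sE subrK.
by rewrite -(eqP ij) opprB addrK.
Qed.

(** The first tensor factor now lies in [L (- i)], so the sign is read off [- i] instead of
    [s i]. *)
Fact right_adjoint_char_subproof P (f : character (bar_degree L P n)) i (x : P (s i)) :
  ((fun y => character_fun f (bar_tens (deg i) y x) *~ half_sign (- i)) :
    product (fun _ : L (- i) => QmodZ)) \in @is_character (L (- i)).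
Proof.
have [bl _ _] := (pairing_of_character f).1 _ _ (deg i).
apply/asboolP => y z.
apply: (addIr (character_fun f (bar_tens (deg i) z x) *~ half_sign (- i))).
by rewrite -bl !subrK.
Qed.

Definition right_adjoint_char P f i x : right_character (L (- i)) :=
  Character (@right_adjoint_char_subproof P f i x).

Fact right_adjoint_subproof P f :
  @is_chain_map _ (shift sE P) (right_dual L) (@right_adjoint_char P f).
Proof.
have [bB bd] := pairing_of_character f; split=> [i r x x'|m k mk x].
  have [_ br bs] := bB _ _ (deg i).
  apply: character_ext => y; apply: etrans (br _ _ _) _.
  by congr (_ + _); apply/esym/bs.
apply: character_ext => y; apply: esym.
exact: (bd _ _ _ _ (dual_degree mk) (shift_degree sE mk) (deg m) (deg k)).
Qed.

Definition right_adjoint P f : chain_map (shift sE P) (right_dual L) :=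
  mk_chain_map (@right_adjoint_subproof P f).

Lemma right_adjointE P f i x y :
  character_fun (cmap (@right_adjoint P f) i x) y =
  character_fun f (bar_tens (deg i) y x) *~ half_sign (- i).
Proof. by []. Qed.

Lemma right_adjoint0 P : @right_adjoint P 0 = 0.
Proof.
apply: chain_map_ext => i x; apply: character_ext => y.
by rewrite right_adjointE; apply: mul0rz.
Qed.

Lemma right_adjoint_inj P : injective (@right_adjoint P).
Proof.
move=> f g fg; apply: bar_character_ext => j i ij y x.
have [k ki kj] := deg_inv ij.
case: _ / ki ij x; case: _ / kj y => y ij x; rewrite (bool_irrelevance ij (deg k)).
have : cmap (right_adjoint f) k x = cmap (right_adjoint g) k x by rewrite fg.
move=> /(congr1 (fun h => character_fun h y *~ half_sign (- k))).
by rewrite !right_adjointE -!mulrzA half_sign_sqr.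
Qed.

Lemma right_adjoint_surj P (g : chain_map (shift sE P) (right_dual L)) :
  exists f, right_adjoint f = g.
Proof.
have e1 i : i = s (i - n) by rewrite sE subrK.
have e2 j i (ij : j + i == n) : j = - (i - n).
  by rewrite -(eqP ij) opprB addrK.
pose b j i (ij : j + i == n) (y : L j) (x : P i) : QmodZ :=
  character_fun (cmap g (i - n) (ccast (e1 i) x)) (ccast (e2 j i ij) y).
have bE k (ij : - k + s k == n) (y : L (- k)) (x : P (s k)) :
    b _ _ ij y x = character_fun (cmap g k x) y.
  rewrite /b; move: (e1 (s k)) (e2 (- k) (s k) ij).
  have -> : s k - n = k by rewrite sE addrK.
  by move=> e e'; rewrite !ccast_id.
have [|f fP] := @character_of_pairing _ L P n b.
  split=> [j i ij|j j' i i' jj' ii' ij1 ij2 y x].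
    split=> [y y' x|y x x'|r y x]; rewrite /b.
    - by rewrite !linearD raddfD.
    - by rewrite !linearD.
    - by rewrite !linearZ.
  have [k ki kj] := deg_inv ij2; have [k' ki' kj'] := deg_inv ij1.
  case: _ / ki ii' ij2; case: _ / ki' ij1 x => ij1 x ii'.
  case: _ / kj jj' y; case: _ / kj' ij1 => ij1 jj' y ij2.
  have mk : k' = k + 1 by apply: (addIr n); rewrite -sE ii' sE addrAC.
  rewrite !bE (eq_irrelevance ii' (shift_degree sE mk)).
  rewrite (eq_irrelevance jj' (dual_degree mk)).
  exact: (esym (congr1 (fun h => character_fun h y) (cmapE g mk x))).
exists f; apply: chain_map_ext => k x; apply: character_ext => y.
by rewrite right_adjointE fP bE -mulrzA half_sign_sqr.
Qed.

Lemma right_adjoint_precomp P Q (h : chain_map P Q) (f : character (bar_degree L Q n)) :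
  right_adjoint (character_comp (cmap (bar_tensor_map (chain_id L) h) n) f) =
  precomp (shift_map sE h) (right_adjoint f).
Proof.
apply: chain_map_ext => i x; apply: character_ext => y.
rewrite right_adjointE.
change (character_fun f (cmap (bar_tensor_map (chain_id L) h) n (bar_tens (deg i) y x))
    *~ half_sign (- i) =
  character_fun f (bar_tens (deg i) y (cmap h (s i) x)) *~ half_sign (- i)).
by rewrite bar_tensor_map_tens.
Qed.

Lemma barTor1r_Ext1 X (P : projective_resolution X) :
  trivial_group (barTor1r L P n) <->
  trivial_group (Ext1 (shift_resolution sE P) (right_dual L)).
Proof.
apply: (@homology_character _ _ _ _ _ _ _ _ _ _ (@right_adjoint (P 0%N))
  (@right_adjoint (P 1%N)) (@right_adjoint (P 2%N))).
- by move=> f; apply: right_adjoint_precomp.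
- by move=> f; apply: right_adjoint_precomp.
- exact: right_adjoint_inj.
- exact: right_adjoint_inj.
- exact: right_adjoint0.
- exact: right_adjoint_surj.
- exact: right_adjoint_surj.
Qed.

End RightDualPairing.

(** * Level complexes and their duals *)

Section Level.
Variable R : pzRingType.

Let id0 (i : int) : id i = i + 0. Proof. by rewrite addr0. Qed.

(** For [s := id] the shift has the same modules by conversion; its differentials differ only in a
    proof of an equation between integers, which is irrelevant. *)
Lemma shift_id_Ext1 (S : pzRingType) (X : chain_complex S) (P : projective_resolution X) A :
  trivial_group (Ext1 (shift_resolution id0 P) A) -> trivial_group (Ext1 P A).
Proof.
rewrite /Ext1 => /homology_trivialP H; apply/homology_trivialP => f fd.
have idP (C : chain_complex S) (g : chain_map C A) : @is_chain_map S (shift id0 C) A (cmap g).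
  split=> [n|m n mn x]; first exact: (linearP (cmap g n)).
  by rewrite -cmapE /= (eq_irrelevance (shift_degree id0 mn) mn).
have idP' (C : chain_complex S) (g : chain_map (shift id0 C) A) : @is_chain_map S C A (cmap g).
  split=> [n|m n mn x]; first exact: (linearP (cmap g n)).
  by rewrite -cmapE /= (eq_irrelevance (shift_degree id0 mn) mn).
have [|g gf] := H (mk_chain_map (idP _ f)).
  apply: chain_map_ext => n x; change (cmap (precomp (res_diff P 1%N) f) n x = 0).
  by rewrite [precomp _ f]fd.
exists (mk_chain_map (idP' _ g)); apply: chain_map_ext => n x.
have := congr1 (fun h : chain_map (shift id0 (P 1%N)) A => cmap h n x) gf.
by [].
Qed.

(** Degree 0 of Tor yields the forward direction; the reverse one uses Ext^1 of every shift of
    [X]. *)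
Theorem left_level_dual (L : chain_complex R) :
  left_level L <-> absolutely_clean (left_dual L).
Proof.
split=> LL X XFP P.
  exact/shift_id_Ext1/barTor1l_Ext1/LL.
move=> n; apply/(barTor1l_Ext1 (s := fun i => i + n) L (fun=> erefl)).
by apply: LL; apply: shift_FP.
Qed.

Theorem right_level_dual (L : chain_complex R^c) :
  right_level L <-> absolutely_clean (right_dual L).
Proof.
split=> LL X XFP P.
  exact/shift_id_Ext1/barTor1r_Ext1/LL.
move=> n; apply/(barTor1r_Ext1 (s := fun i => i + n) L (fun=> erefl)).
by apply: LL; apply: shift_FP.
Qed.

End Level.

(** * Comparison of projective resolutions *)

Section Image.
Variables (R : pzRingType) (X Y : chain_complex R) (g : chain_map X Y).

Definition in_image n : {pred Y n} := fun y => `[< exists x, cmap g n x = y >].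

Fact in_image_submod_closed n : submod_closed (@in_image n).
Proof.
split=> [|a u v /asboolP[x <-] /asboolP[y <-]]; apply/asboolP.
  by exists 0; rewrite linear0.
by exists (a *: x + y); rewrite linearP.
Qed.

HB.instance Definition _ n :=
  GRing.isSubmodClosed.Build R (Y n) (@in_image n) (@in_image_submod_closed n).

Record image_elt n := ImageElt { image_val :> Y n; image_valP : image_val \in @in_image n }.

HB.instance Definition _ n := [isSub for @image_val n].
HB.instance Definition _ n := [Choice of image_elt n by <:].
HB.instance Definition _ n := [SubChoice_isSubLmodule of image_elt n by <:].

Fact image_diff_subproof m n (mn : m = n + 1) (y : image_elt m) :
  cdiff Y mn (image_val y) \in @in_image n.
Proof.
case: y => y /= /asboolP[x <-]; apply/asboolP.
by exists (cdiff X mn x); rewrite cmapE.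
Qed.

Definition image_diff m n (mn : m = n + 1) (y : image_elt m) : image_elt n :=
  ImageElt (image_diff_subproof mn y).

Fact image_diff_is_linear m n (mn : m = n + 1) : linear (image_diff mn).
Proof. by move=> a x y; apply/val_inj; rewrite /= linearP. Qed.

HB.instance Definition _ m n mn := GRing.isLinear.Build R (image_elt m) (image_elt n) _
  (@image_diff m n mn) (@image_diff_is_linear m n mn).

Fact image_diffK l m n (lm : l = m + 1) (mn : m = n + 1) y :
  image_diff mn (image_diff lm y) = 0.
Proof. by apply/val_inj; rewrite /= cdiffK. Qed.

Definition image_complex : chain_complex R :=
  ChainComplex (cobj := fun n => image_elt n)
    (cdiff := fun m n mn => @image_diff m n mn) image_diffK.

(** [projective] lifts along epimorphisms only, so both [g] and [f] are first corestricted to the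
    image complex of [g]. *)
Lemma projective_lift P (f : chain_map P Y) : projective P ->
  (forall n p, exists x, cmap g n x = cmap f n p) ->
  exists h : chain_map P X, forall n p, cmap g n (cmap h n p) = cmap f n p.
Proof.
move=> Pproj fg.
have gP : @is_chain_map R X image_complex
    (fun n x => ImageElt (asboolT (ex_intro _ x erefl :
      exists x', cmap g n x' = cmap g n x))).
  split=> [n a x y|m n mn x]; apply/val_inj; first exact: linearP.
  exact: cmapE.
have fP : @is_chain_map R P image_complex (fun n p => ImageElt (asboolT (fg n p))).
  split=> [n a x y|m n mn x]; apply/val_inj; first exact: linearP.
  exact: cmapE.
have [|h hP] := Pproj _ _ (mk_chain_map gP) (mk_chain_map fP).
  move=> n [y yP]; have /asboolP[x xy] := yP.
  by exists x; apply/val_inj.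
exists h => n p.
exact: (congr1 (fun k : chain_map P image_complex =>
  image_val (cmap k n p : image_elt n)) hP).
Qed.

End Image.

Section Comparison.
Variables (R : pzRingType) (X : chain_complex R) (P Q : projective_resolution X).

Lemma res_diff_aug n x : cmap (res_aug P) n (cmap (res_diff P 0%N) n x) = 0.
Proof. by apply/res_exact0; exists x. Qed.

Lemma res_diff_diff k n x :
  cmap (res_diff P k) n (cmap (res_diff P k.+1) n x) = 0.
Proof. by apply/res_exactS; exists x. Qed.

Lemma res_lift0 : exists f : chain_map (P 0%N) (Q 0%N),
  forall n x, cmap (res_aug Q) n (cmap f n x) = cmap (res_aug P) n x.
Proof.
by apply: projective_lift; [exact: res_projective | move=> n x; exact: res_aug_epi].
Qed.

Lemma res_lift1 (f : chain_map (P 0%N) (Q 0%N)) :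
  (forall n x, cmap (res_aug Q) n (cmap f n x) = cmap (res_aug P) n x) ->
  exists g : chain_map (P 1%N) (Q 1%N), forall n x,
    cmap (res_diff Q 0%N) n (cmap g n x) = cmap f n (cmap (res_diff P 0%N) n x).
Proof.
move=> fP; apply: (projective_lift (f := precomp (res_diff P 0%N) f)).
  exact: res_projective.
by move=> n x; apply/res_exact0; rewrite fP res_diff_aug.
Qed.

End Comparison.

(** The maps [psi] and [phi] compare the resolutions in both directions, [s0] and [s1] form a
    homotopy between [phi psi] and the identity of [Q], and [phi2] serves to make [f phi1] a
    cocycle. *)
Lemma Ext1_comparison (R : pzRingType) (X : chain_complex R)
    (P Q : projective_resolution X) A :
  trivial_group (Ext1 P A) -> trivial_group (Ext1 Q A).
Proof.
rewrite !homology_trivialP => PA f fd.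
have [psi0 psi0E] := res_lift0 Q P; have [phi0 phi0E] := res_lift0 P Q.
have [psi1 psi1E] := res_lift1 psi0E; have [phi1 phi1E] := res_lift1 phi0E.
have [|n x|phi2 phi2E] := @projective_lift _ _ _ (res_diff Q 1%N) (P 2%N)
    (precomp (res_diff P 1%N) phi1); first exact: res_projective.
  by apply/res_exactS; rewrite phi1E res_diff_diff linear0.
have [|n x|s0 s0E] := @projective_lift _ _ _ (res_diff Q 0%N) (Q 0%N)
    (precomp psi0 phi0 - chain_id (Q 0%N)); first exact: res_projective.
  by apply/res_exact0; rewrite linearB /= phi0E psi0E subrr.
have [|n x|s1 s1E] := @projective_lift _ _ _ (res_diff Q 1%N) (Q 1%N)
    (precomp psi1 phi1 - chain_id (Q 1%N) - precomp (res_diff Q 0%N) s0).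
- exact: res_projective.
- apply/res_exactS; set d := cmap (res_diff Q 0%N) n.
  change (d (cmap phi1 n (cmap psi1 n x) - x - cmap s0 n (d x)) = 0).
  rewrite /d !linearB /= phi1E psi1E s0E.
  change (cmap phi0 n (cmap psi0 n (d x)) - d x - (cmap phi0 n (cmap psi0 n (d x)) - d x) = 0).
  exact: subrr.
have fdE n x : cmap f n (cmap (res_diff Q 1%N) n x) = 0.
  exact: (congr1 (fun h : chain_map _ _ => cmap h n x) fd).
have [|g gE] := PA (precomp phi1 f).
  apply: chain_map_ext => n x.
  change (cmap f n (cmap (precomp (res_diff P 1%N) phi1) n x) = 0).
  by rewrite -phi2E fdE.
(* Apply [f] to [d s1 = phi1 psi1 - 1 - s0 d]: with [f d = 0], [f phi1 = g d] and [d psi1 = psi0 d]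
   this gives [f = (g psi0 - f s0) d]. *)
exists (precomp psi0 g - precomp s0 f); apply: chain_map_ext => n x.
have gE' y : cmap g n (cmap (res_diff P 0%N) n y) = cmap f n (cmap phi1 n y).
  exact: (congr1 (fun h : chain_map _ _ => cmap h n y) gE).
have : cmap f n (cmap (res_diff Q 1%N) n (cmap s1 n x)) = 0 by rewrite fdE.
rewrite s1E.
change (cmap f n (cmap phi1 n (cmap psi1 n x) - x - cmap s0 n (cmap (res_diff Q 0%N) n x)) = 0 ->
  cmap g n (cmap psi0 n (cmap (res_diff Q 0%N) n x)) -
  cmap f n (cmap s0 n (cmap (res_diff Q 0%N) n x)) = cmap f n x).
rewrite -psi1E gE' !linearB /= => /eqP; rewrite subr_eq0 => /eqP <-.
by rewrite subKr.
Qed.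

Lemma absolutely_cleanP (R : pzRingType) (A : chain_complex R) :
  absolutely_clean A <->
  (forall X (P : projective_resolution X), (forall k, fg_complex (P k)) ->
    trivial_group (Ext1 P A)).
Proof.
split=> [H X P Pfg|H X [P Pfg] Q]; first by apply: H; exists P.
exact/(@Ext1_comparison _ _ P)/H.
Qed.

(** * Free complexes and finitely generated projective complexes *)

(* The number m of generators is the same in every degree, so that the
   differential needs no cast. *)
Section DiscComplex.
Variables (R : pzRingType) (m : nat).

Definition disc_degree : lmodType R := ('rV[R]_m * 'rV[R]_m)%type.

Definition disc_diff (u : disc_degree) : disc_degree := (0, u.1).

Fact disc_diff_is_linear : linear disc_diff.
Proof.
by move=> a u v; apply: injective_projections => //=; rewrite scaler0 addr0.
Qed.

HB.instance Definition _ := GRing.isLinear.Build R disc_degree disc_degree _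
  disc_diff disc_diff_is_linear.

Definition disc : chain_complex R :=
  ChainComplex (cobj := fun _ => disc_degree)
    (cdiff := fun _ _ _ => disc_diff) (fun _ _ _ _ _ _ => erefl).

Definition graded_family (Y : chain_complex R) : zmodType :=
  product (fun k : int => product (fun _ : 'I_m => Y k)).

Variable Y : chain_complex R.

(** The [j]-th basis vector of the first copy of R^m in degree [n] goes to [e n j]. An element
    [(0, b)] of degree [n] is the boundary of [(b, 0)] in degree [n + 1], which forces the second
    sum. *)
Definition disc_fun (e : graded_family Y) (n : int) (u : disc n) : Y n :=
  \sum_j u.1 0 j *: e n j + \sum_j u.2 0 j *: cdiff Y (erefl (n + 1)) (e (n + 1) j).

Fact disc_map_subproof (e : graded_family Y) : is_chain_map (disc_fun e).
Proof.
split=> [n a u v|k n kn u].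
  rewrite /disc_fun scalerDr addrACA !scaler_sumr.
  by congr (_ + _); rewrite -big_split; apply: eq_bigr => j _; rewrite !mxE scalerDl scalerA.
subst k; change (\sum_j (0 : 'rV[R]_m) 0 j *: e n j +
  \sum_j u.1 0 j *: cdiff Y (erefl (n + 1)) (e (n + 1) j) =
  cdiff Y (erefl (n + 1)) (disc_fun e u)).
rewrite [X in X + _ = _]big1 => [|j _]; last by rewrite mxE scale0r.
rewrite add0r linearD !linear_sum /= [X in _ = _ + X]big1 => [|j _].
  by rewrite addr0; apply: eq_bigr => j _; rewrite linearZ.
by rewrite linearZ /= cdiffK scaler0.
Qed.

Definition disc_map (e : graded_family Y) : chain_map disc Y := mk_chain_map (disc_map_subproof e).

Lemma disc_mapE e n u : cmap (disc_map e) n u =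
  \sum_j u.1 0 j *: e n j + \sum_j u.2 0 j *: cdiff Y (erefl (n + 1)) (e (n + 1) j).
Proof. by []. Qed.

Fact disc_map_is_zmod_morphism : zmod_morphism disc_map.
Proof.
move=> e e'; apply: chain_map_ext => n u.
change (cmap (disc_map (e - e')) n u = cmap (disc_map e) n u - cmap (disc_map e') n u).
rewrite !disc_mapE opprD addrACA.
by congr (_ + _); rewrite -sumrB; apply: eq_bigr => j _; rewrite -scalerBr // -raddfB.
Qed.

HB.instance Definition _ := GRing.isZmodMorphism.Build (graded_family Y) (chain_map disc Y)
  disc_map disc_map_is_zmod_morphism.

End DiscComplex.

Section FinitelyGenerated.
Variable R : pzRingType.

Definition generated_by (M : lmodType R) (k : nat) : Prop :=
  exists e : 'I_k -> M, forall x, exists c : 'I_k -> R, x = \sum_(i < k) c i *: e i.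

Lemma generated_by_leq (M : lmodType R) k l :
  (k <= l)%N -> generated_by M k -> generated_by M l.
Proof.
move=> kl [e eP]; rewrite -(subnKC kl).
exists (fun i => if fintype.split i is inl j then e j else 0) => x.
have [c ->] := eP x; exists (fun i => if fintype.split i is inl j then c j else 0).
rewrite big_split_ord /= [X in _ = _ + X]big1 => [|i _].
  rewrite addr0; apply: eq_bigr => i _.
  by have := unsplitK (inl i : 'I_k + 'I_(l - k)) => /= ->.
by have := unsplitK (inr i : 'I_k + 'I_(l - k)) => /= ->; rewrite scaler0.
Qed.

Lemma fg_complex_uniform (X : chain_complex R) : fg_complex X ->
  exists m, forall n, generated_by (X n) m.
Proof.
move=> [[N XN] Xfg]; have [k kP] := choice Xfg.
(* [i] and [- i] cover all degrees of absolute value at most that of [N]; the complex is zero in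
   those above [N]. *)
pose m := \max_(i < `|N|.+1) maxn (k i%:Z) (k (- i%:Z)).
exists m => n; case: (pselect (N < `|n|)) => [/XN X0|/negP].
  exists (fun _ => 0) => x; exists (fun _ => 0).
  by rewrite (X0 x) big1 // => i _; rewrite scaler0.
rewrite -leNgt => nN.
have nlt : (`|n| < `|N|.+1)%N.
  by rewrite ltnS -lez_nat !abszE (le_trans nN) // ler_norm.
apply: generated_by_leq (kP n).
apply: leq_trans (leq_bigmax (Ordinal nlt)).
by rewrite leq_max /=; case: (intP n) => [|p|p]; rewrite ?abszN /= ?leqnn ?orbT.
Qed.

(** A dual basis lemma for complexes: generators of all the [P n] define an epimorphism from [disc],
    which projectivity splits by [h]. *)
Lemma fg_projective_basis (P : chain_complex R) : projective P -> fg_complex P ->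
  exists m (e : graded_family m P) (h : chain_map P (disc R m)),
    precomp h (disc_map e) = chain_id P.
Proof.
move=> Pproj /fg_complex_uniform[m Pm].
pose e n := projT1 (cid (Pm n)); have eP n := projT2 (cid (Pm n)).
exists m, e.
apply: Pproj => n x; have [c xE] := eP n x.
exists ((\row_j c j, 0) : disc_degree R m);
rewrite disc_mapE /= [X in _ + X = _]big1 => [|j _].
  by rewrite addr0 [RHS]xE; apply: eq_bigr => j _; rewrite mxE.
by rewrite mxE scale0r.
Qed.

End FinitelyGenerated.

(** * Finite coordinates on Hom(P, A) *)

(** [n + 1] is required besides [n] because [disc_map e] in degree [n] reads [e] in both degrees.
    Hence the range from [-M] to [M + 1], of length [2M + 2]. *)
Lemma bounded_range (R : pzRingType) (P : chain_complex R) : bounded P ->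
  exists2 r : seq int, uniq r &
    forall n, trivial_group (P n) \/ (n \in r /\ n + 1 \in r).
Proof.
move=> [N PN]; pose M := `|N|%N.
exists [seq i%:Z - M%:Z | i <- iota 0 (M + M).+2].
  rewrite map_inj_uniq ?iota_uniq // => i j /addIr; by case.
move=> n; case: (pselect (N < `|n|)) => [/PN|/negP]; first by left.
rewrite -leNgt => nN; right.
have : `|n| <= M%:Z by rewrite /M abszE (le_trans nN) // ler_norm.
rewrite ler_norml => /andP[Mn nM].
have inr (k : int) : - M%:Z <= k -> k <= M%:Z + 1 ->
    k \in [seq i%:Z - M%:Z | i <- iota 0 (M + M).+2].
  move=> Mk kM; apply/mapP; exists (absz (k + M%:Z)).
    rewrite mem_iota add0n -ltz_nat gez0_abs; last by rewrite -lerBlDr sub0r.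
    by lia.
  by rewrite gez0_abs ?addrK // -lerBlDr sub0r.
by split; apply: inr; lia.
Qed.

Section Delta.
Variables (R : pzRingType) (m : nat) (A : chain_complex R).

Definition delta_at k (j : 'I_m) n (j' : 'I_m) (a : A k) : A n :=
  if pselect (k = n) is left kn then if j == j' then ccast kn a else 0 else 0.

Lemma delta_at_neq k j n j' a : k <> n -> @delta_at k j n j' a = 0.
Proof. by rewrite /delta_at; case: pselect. Qed.

Lemma delta_at_id k j j' a : @delta_at k j k j' a = if j == j' then a else 0.
Proof. by rewrite /delta_at; case: pselect => // e; rewrite ccast_id. Qed.

Fact delta_at_is_zmod_morphism k j n j' : zmod_morphism (@delta_at k j n j').
Proof.
move=> a b; rewrite /delta_at; case: pselect => [kn|_]; last by rewrite subrr.
by case: ifP; rewrite ?subrr // linearB.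
Qed.

HB.instance Definition _ k j n j' := GRing.isZmodMorphism.Build (A k) (A n)
  (@delta_at k j n j') (@delta_at_is_zmod_morphism k j n j').

Definition delta k (j : 'I_m) (a : A k) : graded_family m A := fun n j' => delta_at j n j' a.

Fact delta_is_zmod_morphism k j : zmod_morphism (@delta k j).
Proof.
move=> a b; do 2 apply: functional_extensionality_dep => ?.
exact: (raddfB (@delta_at k j _ _)).
Qed.

HB.instance Definition _ k j := GRing.isZmodMorphism.Build (A k) (graded_family m A)
  (@delta k j) (@delta_is_zmod_morphism k j).

Lemma sum_delta (r : seq int) (f : graded_family m A) n j : uniq r -> n \in r ->
  (\sum_(k <- r) \sum_i delta i (f k i)) n j = f n j.
Proof.
move=> r_uniq nr.
have famE (I : Type) (s : seq I) (F : I -> graded_family m A) :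
    (\sum_(i <- s) F i) n j = \sum_(i <- s) F i n j.
  by elim/big_rec2: _ => // i x y _ <-.
rewrite famE (bigD1_seq n) //= [X in _ + X = _]big1 => [|k kn]; last first.
  rewrite famE big1 // => i _; apply: delta_at_neq; exact/eqP.
rewrite addr0 famE (bigD1 j) //= [X in _ + X = _]big1 => [|i ij].
  by rewrite addr0 [LHS]delta_at_id eqxx.
by rewrite [LHS]delta_at_id (negPf ij).
Qed.

End Delta.

Lemma disc_map_local (R : pzRingType) m (Y : chain_complex R) (e f : graded_family m Y) n u :
  e n = f n -> e (n + 1) = f (n + 1) -> cmap (disc_map e) n u = cmap (disc_map f) n u.
Proof. by move=> en en1; rewrite !disc_mapE en en1. Qed.

Lemma disc_map_precomp (R : pzRingType) m (P Y : chain_complex R) (e : graded_family m P)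
    (f : chain_map P Y) :
  precomp (disc_map e) f = disc_map (fun n j => cmap f n (e n j) : Y n).
Proof.
apply: chain_map_ext => n u.
change (cmap f n (cmap (disc_map e) n u) =
  cmap (disc_map (fun n j => cmap f n (e n j) : Y n)) n u).
rewrite !disc_mapE linearD !linear_sum /=.
by congr (_ + _); apply: eq_bigr => j _; rewrite linearZ //= cmapE.
Qed.

Section Coordinates.
Variables (R : pzRingType) (P : chain_complex R) (m : nat) (e : graded_family m P).
Variables (h : chain_map P (disc R m)) (r : seq int).
Hypotheses (he : precomp h (disc_map e) = chain_id P) (r_uniq : uniq r).
Hypothesis rP : forall n, trivial_group (P n) \/ (n \in r /\ n + 1 \in r).

Definition coord_map (A : chain_complex R) k j (a : A k) : chain_map P A :=
  precomp h (disc_map (delta j a)).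

Fact coord_map_is_zmod_morphism (A : chain_complex R) k j : zmod_morphism (@coord_map A k j).
Proof. by move=> a b; rewrite /coord_map !raddfB. Qed.

HB.instance Definition _ (A : chain_complex R) (k : int) (j : 'I_m) :=
  GRing.isZmodMorphism.Build (A k) (chain_map P A)
    (@coord_map A k j) (@coord_map_is_zmod_morphism A k j).

(** [f] is the composite of [h], [disc_map e] and [f], and the last two compose to the [disc_map] of
    the family [f (e k j)]. Where [P] is nonzero, this family may be replaced by its part supported
    in [r], a finite sum of deltas. *)
Lemma coord_map_sum (A : chain_complex R) (f : chain_map P A) :
  f = \sum_(k <- r) \sum_j coord_map j (cmap f k (e k j)).
Proof.
have -> : \sum_(k <- r) \sum_j coord_map j (cmap f k (e k j)) =
    precomp h (disc_map (\sum_(k <- r) \sum_j delta j (cmap f k (e k j)))).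
  by rewrite !raddf_sum; apply: eq_bigr => k _; rewrite !raddf_sum.
apply: chain_map_ext => n x; have [Pn|[nr n1r]] := rP n.
  by rewrite (Pn x) !linear0.
have -> : x = cmap (disc_map e) n (cmap h n x).
  exact: (esym (congr1 (fun g : chain_map P P => cmap g n x) he)).
set u := cmap h n x.
change (cmap (precomp (disc_map e) f) n u = cmap
  (disc_map (\sum_(k <- r) \sum_j delta j (cmap f k (e k j)))) n
  (cmap h n (cmap (disc_map e) n u))).
have -> : cmap h n (cmap (disc_map e) n u) = u.
  congr (cmap h n _).
  exact: (congr1 (fun g : chain_map P P => cmap g n x) he).
rewrite disc_map_precomp; apply: disc_map_local;
  apply: functional_extensionality_dep => j; apply/esym;
  exact: (sum_delta (fun k j => cmap f k (e k j) : A k)).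
Qed.

End Coordinates.

(** * Double characters of Hom(P, A) *)

Section CharacterMap.
Variables (M N : zmodType) (f : {additive M -> N}).

Fact character_comp_is_zmod_morphism : zmod_morphism (character_comp f).
Proof. by move=> g h; apply: character_ext. Qed.

HB.instance Definition _ := GRing.isZmodMorphism.Build (character N) (character M)
  (character_comp f) character_comp_is_zmod_morphism.

End CharacterMap.

Lemma character_funD (M : zmodType) (f g : character M) x :
  character_fun (f + g) x = character_fun f x + character_fun g x.
Proof. by []. Qed.

Lemma character_fun_sum (M : zmodType) I (s : seq I) (f : I -> character M) x :
  character_fun (\sum_(i <- s) f i) x = \sum_(i <- s) character_fun (f i) x.
Proof. by elim/big_rec2: _ => // i y g _ <-. Qed.

(* B is A^++ degreewise. It is kept abstract because (A^++)_n is formed from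
   A_(-(-n)), which is not convertible to A_n. *)
Record bidual (R : pzRingType) (A B : chain_complex R) := Bidual {
  bd : forall n, {additive B n -> character (character (A n))};
  bd_inj : forall n, injective (bd n);
  bd_surj : forall n f, exists b, bd n b = f;
  bd_scale : forall n r b (f : character (A n)),
    character_fun (bd n (r *: b)) f =
    character_fun (bd n b) (character_comp ( *:%R r) f);
  bd_diff : forall m n (mn : m = n + 1) b (f : character (A n)),
    character_fun (bd n (cdiff B mn b)) f =
    character_fun (bd m b) (character_comp (cdiff A mn) f) }.

Section BidualHom.
Variables (R : pzRingType) (A B : chain_complex R) (D : bidual A B).
Local Notation bd := (bd D).

(* beta is the second transpose of alpha. *)
Definition compat k n (alpha : A k -> A n) (beta : B k -> B n) : Prop :=
  zmod_morphism alpha /\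
  forall b (f : character (A n)) (g : character (A k)),
    (forall a, character_fun g a = character_fun f (alpha a)) ->
    character_fun (bd n (beta b)) f = character_fun (bd k b) g.

Lemma compat_comp k l n alpha beta alpha' beta' :
  @compat k l alpha beta -> @compat l n alpha' beta' ->
  compat (alpha' \o alpha) (beta' \o beta).
Proof.
move=> [aB ab] [a'B ab']; split=> [x y|b f g fg]; first by rewrite /= aB a'B.
have fP : ((fun a => character_fun f (alpha' a)) : product (fun _ : A l => QmodZ))
    \in @is_character (A l).
  by apply/asboolP => x y; rewrite a'B raddfB.
by rewrite (ab' _ _ (Character fP)) // (ab _ _ g).
Qed.

Lemma compat0 k n : @compat k n (fun=> 0) (fun=> 0).
Proof.
split=> [x y|b f g fg]; first by rewrite subrr.
rewrite raddf0; suff -> : g = 0 by rewrite raddf0.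
by apply: character_ext => a; rewrite fg raddf0.
Qed.

Lemma compatD k n alpha beta alpha' beta' :
  @compat k n alpha beta -> @compat k n alpha' beta' ->
  compat (fun a => alpha a + alpha' a) (fun b => beta b + beta' b).
Proof.
move=> [aB ab] [a'B ab']; split=> [x y|b f g fg].
  by rewrite aB a'B opprD addrACA.
have fP : ((fun a => character_fun f (alpha a)) : product (fun _ : A k => QmodZ))
    \in @is_character (A k).
  by apply/asboolP => x y; rewrite aB raddfB.
have fP' : ((fun a => character_fun f (alpha' a)) : product (fun _ : A k => QmodZ))
    \in @is_character (A k).
  by apply/asboolP => x y; rewrite a'B raddfB.
have -> : g = Character fP + Character fP'.
  by apply: character_ext => a; rewrite fg raddfD.
by rewrite !raddfD character_funD (ab b f (Character fP)) // (ab' b f (Character fP')).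
Qed.

Lemma compat_sum k n I (s : seq I) (alpha : I -> A k -> A n) beta :
  (forall i, compat (alpha i) (beta i)) ->
  compat (fun a => \sum_(i <- s) alpha i a) (fun b => \sum_(i <- s) beta i b).
Proof.
move=> ab; elim: s => [|i s IHs].
  rewrite [X in compat X](_ : _ = fun=> 0); last first.
    by apply: functional_extensionality_dep => a; rewrite big_nil.
  rewrite [X in compat _ X](_ : _ = fun=> 0); last first.
    by apply: functional_extensionality_dep => a; rewrite big_nil.
  exact: compat0.
rewrite [X in compat X](_ : _ = fun a => alpha i a + \sum_(i <- s) alpha i a);
    last first.
  by apply: functional_extensionality_dep => a; rewrite big_cons.
rewrite [X in compat _ X](_ : _ = fun a => beta i a + \sum_(i <- s) beta i a);
    last first.
  by apply: functional_extensionality_dep => a; rewrite big_cons.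
exact: compatD.
Qed.

Lemma compat_scale n r : @compat n n ( *:%R r) ( *:%R r).
Proof.
split=> [x y|b f g fg]; first exact: scalerBr.
by rewrite bd_scale; congr character_fun; apply: character_ext => a; rewrite fg.
Qed.

Lemma compat_diff k n (kn : k = n + 1) : compat (cdiff A kn) (cdiff B kn).
Proof.
split=> [|b f g fg]; first exact: raddfB.
by rewrite bd_diff; congr character_fun; apply: character_ext => a; rewrite fg.
Qed.

Lemma compat_delta m k n (j j' : 'I_m) :
  compat (@delta_at R m A k j n j') (@delta_at R m B k j n j').
Proof.
split=> [|b f g fg]; first exact: raddfB.
case: (pselect (k = n)) fg => [kn|kn] fg; last first.
  rewrite delta_at_neq // raddf0; suff -> : g = 0 by rewrite raddf0.
  by apply: character_ext => a; rewrite fg delta_at_neq // raddf0.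
subst n; rewrite delta_at_id; case: ifP => jj'.
  by congr character_fun; apply: character_ext => a; rewrite fg delta_at_id jj'.
rewrite raddf0; suff -> : g = 0 by rewrite raddf0.
by apply: character_ext => a; rewrite fg delta_at_id jj' raddf0.
Qed.

(** Once the coordinates of [cmap h n x] are fixed, the map is a finite sum of composites of
    [delta_at], scalings and the differential, each of which is respected by double
    transposition. *)
Lemma compat_coord m (P : chain_complex R) (h : chain_map P (disc R m)) k (j : 'I_m) n x :
  compat (fun a : A k => cmap (coord_map h j a) n x)
         (fun b : B k => cmap (coord_map h j b) n x).
Proof.
apply: compatD; apply: compat_sum => i.
  exact: compat_comp (compat_delta _ _ _ _) (compat_scale _ _).
apply: compat_comp (compat_scale _ _).
exact: compat_comp (compat_delta _ _ _ _) (compat_diff _).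
Qed.

Section Transpose.
Variable P : chain_complex R.

Definition cmap_at n (x : P n) (f : chain_map P A) : A n := cmap f n x.

Fact cmap_at_is_zmod_morphism n x : zmod_morphism (@cmap_at n x).
Proof. by []. Qed.

HB.instance Definition _ n x := GRing.isZmodMorphism.Build (chain_map P A) (A n)
  (@cmap_at n x) (@cmap_at_is_zmod_morphism n x).

Fact bidual_hom_char_subproof (t : character (character (chain_map P A))) n (x : P n) :
  ((fun f => character_fun t (character_comp (cmap_at x) f)) :
    product (fun _ : character (A n) => QmodZ)) \in @is_character (character (A n)).
Proof. by apply/asboolP => f g; rewrite !raddfB. Qed.

(** The canonical map Hom(P, A)^++ -> Hom(P, A^++): [t] is sent at [x] to its image under the second
    transpose of evaluation at [x], read in [B n] through [bd]. *)
Definition bidual_hom_fun (t : character (character (chain_map P A))) n (x : P n) : B n :=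
  projT1 (cid (bd_surj D (Character (bidual_hom_char_subproof t x)))).

Lemma bidual_hom_funE t n x f :
  character_fun (bd n (@bidual_hom_fun t n x)) f =
  character_fun t (character_comp (cmap_at x) f).
Proof. by rewrite (projT2 (cid (bd_surj D _))). Qed.

Fact bidual_hom_subproof t : is_chain_map (@bidual_hom_fun t).
Proof.
split=> [n a x y|m n mn x]; apply: (@bd_inj _ _ _ D n); apply: character_ext => f.
  rewrite raddfD character_funD bd_scale !bidual_hom_funE -raddfD.
  congr character_fun; apply: character_ext => g.
  change (character_fun f (cmap g n (a *: x + y)) =
    character_fun f (a *: cmap g n x) + character_fun f (cmap g n y)).
  by rewrite linearP raddfD.
rewrite bd_diff !bidual_hom_funE; congr character_fun; apply: character_ext => g.
exact: (congr1 (character_fun f) (cmapE g mn x)).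
Qed.

Definition bidual_hom t : chain_map P B := mk_chain_map (bidual_hom_subproof t).

Lemma bidual_homE t n x f :
  character_fun (bd n (cmap (bidual_hom t) n x)) f =
  character_fun t (character_comp (cmap_at x) f).
Proof. exact: bidual_hom_funE. Qed.

Lemma bidual_hom0 : bidual_hom 0 = 0.
Proof.
apply: chain_map_ext => n x; apply: (@bd_inj _ _ _ D n); apply: character_ext => f.
by rewrite bidual_homE raddf0.
Qed.

Variables (m : nat) (e : graded_family m P) (h : chain_map P (disc R m)) (r : seq int).
Hypotheses (he : precomp h (disc_map e) = chain_id P) (r_uniq : uniq r).
Hypothesis rP : forall n, trivial_group (P n) \/ (n \in r /\ n + 1 \in r).

(** By [coord_map_sum] every character of Hom(P, A) is a sum of characters pulled back along
    evaluations at the [e k j], and on these [t] is determined by the values of [bidual_hom t] at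
    the [e k j]. *)
Lemma bidual_hom_inj : injective bidual_hom.
Proof.
move=> t t' tt'; apply: character_ext => f.
have -> : f = \sum_(k <- r) \sum_j
    character_comp (cmap_at (e k j)) (character_comp (coord_map h j) f).
  apply: character_ext => g; rewrite [in LHS](coord_map_sum he r_uniq rP g).
  rewrite raddf_sum character_fun_sum; apply: eq_bigr => k _.
  by rewrite raddf_sum character_fun_sum.
rewrite !raddf_sum; apply: eq_bigr => k _; rewrite !raddf_sum; apply: eq_bigr => j _.
by rewrite /= -!bidual_homE tt'.
Qed.

Lemma bidual_hom_surj (g : chain_map P B) : exists t, bidual_hom t = g.
Proof.
pose cm k j : {additive A k -> chain_map P A} := coord_map h j.
(* The coordinate expansion of [g] lifted to Hom(P, A)^++: each value [g (e k j)] is pushed along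
   the second transpose of [coord_map]. [compat_coord] matches it term by term with [coord_map_sum]
   for [B]. *)
exists (\sum_(k <- r) \sum_j
  character_comp (character_comp (cm k j)) (bd k (cmap g k (e k j)))).
apply: chain_map_ext => n x; apply: (@bd_inj _ _ _ D n); apply: character_ext => f.
rewrite bidual_homE [in RHS](coord_map_sum he r_uniq rP g).
have cmapS I (s : seq I) (F : I -> chain_map P B) :
    cmap (\sum_(i <- s) F i) n x = \sum_(i <- s) cmap (F i) n x.
  by elim/big_rec2: _ => // i y z _ <-.
rewrite cmapS raddf_sum !character_fun_sum; apply: eq_bigr => k _.
rewrite cmapS raddf_sum !character_fun_sum; apply: eq_bigr => j _.
exact: (esym ((compat_coord h k j x).2 (cmap g k (e k j)) f
  (character_comp (cm k j) (character_comp (cmap_at x) f)) (fun=> erefl))).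
Qed.

End Transpose.

Lemma bidual_hom_precomp P Q (f : chain_map P Q) t :
  bidual_hom (character_comp (character_comp (@precomp R _ _ f A)) t) =
  precomp f (@bidual_hom Q t).
Proof.
apply: chain_map_ext => n x; apply: (@bd_inj _ _ _ D n); apply: character_ext => g.
rewrite bidual_homE [RHS]bidual_homE.
by apply: (congr1 (character_fun t)); apply: character_ext.
Qed.

Theorem bidual_absolutely_clean : absolutely_clean A <-> absolutely_clean B.
Proof.
suff E X (P : projective_resolution X) : (forall k, fg_complex (P k)) ->
    trivial_group (Ext1 P A) <-> trivial_group (Ext1 P B).
  by split=> /absolutely_cleanP H; apply/absolutely_cleanP => X P Pfg;
    apply/(E _ _ Pfg)/H.
move=> Pfg.
(* Exactness is dualised twice: from Hom(P, A) to its characters, identified by [id], and from these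
   to Hom(P, B), identified by [bidual_hom]. *)
apply: iff_trans.
  apply: (@homology_character _ _ _ _ _ _ _ _
    (character_comp (@precomp R _ _ (res_diff P 1%N) A))
    (character_comp (@precomp R _ _ (res_diff P 0%N) A)) id id id) => //.
  - by move=> k; exists k.
  - by move=> k; exists k.
have basis k : exists m (e : graded_family m (P k)) (h : chain_map (P k) (disc R m)) (r : seq int),
    [/\ precomp h (disc_map e) = chain_id (P k), uniq r &
    forall n, trivial_group (P k n) \/ (n \in r /\ n + 1 \in r)].
  have [m [e [h he]]] := fg_projective_basis (@res_projective _ _ P k) (Pfg k).
  by have [r ru rP] := bounded_range (Pfg k).1; exists m, e, h, r.
have inj k : injective (@bidual_hom (P k)).
  by have [m [e [h [r [he ru rP]]]]] := basis k; apply: bidual_hom_inj he ru rP.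
have surj k (g : chain_map (P k) B) : exists t, bidual_hom t = g.
  by have [m [e [h [r [he ru rP]]]]] := basis k; apply: bidual_hom_surj he ru rP g.
apply: (@homology_character _ _ _ _ _ _ _ _ _ _ (@bidual_hom (P 0%N))
  (@bidual_hom (P 1%N)) (@bidual_hom (P 2%N))).
- by move=> f; apply: bidual_hom_precomp.
- by move=> f; apply: bidual_hom_precomp.
- exact: inj.
- exact: inj.
- exact: bidual_hom0.
- exact: surj.
- exact: surj.
Qed.

End BidualHom.

(** * The double dual complex as a bidual *)

Section DoubleNegation.
Variables (R : pzRingType) (A B : chain_complex R).
Variable u : forall n, B n -> character (character (A (- - n))).
Hypotheses (uB : forall n, zmod_morphism (@u n)) (u_inj : forall n, injective (@u n)).
Hypothesis u_surj : forall n f, exists b, @u n b = f.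
Hypothesis u_scale : forall n r b f,
  character_fun (@u n (r *: b)) f = character_fun (u b) (character_comp ( *:%R r) f).
Hypothesis u_diff : forall m n (mn : m = n + 1) b f,
  character_fun (@u n (cdiff B mn b)) f =
  character_fun (u b) (character_comp (cdiff A (dual_degree (dual_degree mn))) f).

Let c n : {additive A (- - n) -> A n} := @ccast R A _ _ (opprK n).
Let c' n : {additive A n -> A (- - n)} := @ccast R A _ _ (esym (opprK n)).

Let cK n (f : character (A (- - n))) : character_comp (c n) (character_comp (c' n) f) = f.
Proof.
apply: character_ext => x.
change (character_fun f (ccast (esym (opprK n)) (ccast (opprK n) x)) = character_fun f x).
by rewrite (ccast_comp _ _ erefl) ccast_id.
Qed.

Let c'K n (f : character (A n)) : character_comp (c' n) (character_comp (c n) f) = f.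
Proof.
apply: character_ext => x.
change (character_fun f (ccast (opprK n) (ccast (esym (opprK n)) x)) = character_fun f x).
by rewrite (ccast_comp _ _ erefl) ccast_id.
Qed.

Definition double_negation_bd n (b : B n) : character (character (A n)) :=
  character_comp (character_comp (c n)) (u b).

Fact double_negation_bd_is_zmod_morphism n : zmod_morphism (@double_negation_bd n).
Proof. by move=> x y; rewrite /double_negation_bd uB raddfB. Qed.

HB.instance Definition _ n := GRing.isZmodMorphism.Build (B n)
  (character (character (A n))) (@double_negation_bd n)
  (@double_negation_bd_is_zmod_morphism n).

(** The casts [c] and [c'] absorb the double negation of degrees once for both double duals,
    left-right and right-left; [u] is the identity in each. *)
Lemma double_negation_bidual : bidual A B.
Proof.
apply: (@Bidual R A B (fun n => @double_negation_bd n)).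
- move=> n x y xy; apply: u_inj; apply: character_ext => f; rewrite -(cK f).
  exact: (congr1 (fun h => character_fun h (character_comp (c' n) f)) xy).
- move=> n f; have [b ub] := u_surj (character_comp (character_comp (c' n)) f).
  exists b; rewrite /= /double_negation_bd ub; apply: character_ext => g.
  by rewrite -[in RHS](c'K g).
- move=> n r b f; apply: etrans (u_scale _ _ _) _.
  apply: (congr1 (character_fun (u b))); apply: character_ext => x.
  by apply: (congr1 (character_fun f)); apply: (linearZ_LR (@ccast R A _ _ (opprK n))).
move=> m n mn b f; apply: etrans (u_diff _ _ _) _.
apply: (congr1 (character_fun (u b))); apply: character_ext => x.
by apply: (congr1 (character_fun f)); apply: esym; apply: cdiff_ccast.
Qed.

End DoubleNegation.

Lemma right_left_bidual (R : pzRingType) (A : chain_complex R) :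
  bidual A (right_dual (left_dual A)).
Proof.
apply: (@double_negation_bidual R A (right_dual (left_dual A)) (fun n b => b)).
- by move=> n x y.
- by move=> n x y.
- by move=> n f; exists f.
- move=> n r b f.
  by apply: (congr1 (character_fun b)); apply: character_ext.
- move=> m n mn b f.
  by apply: (congr1 (character_fun b)); apply: character_ext.
Qed.

Lemma left_right_bidual (R : pzRingType) (A : chain_complex R^c) :
  bidual A (left_dual (right_dual A)).
Proof.
apply: (@double_negation_bidual _ A (left_dual (right_dual A)) (fun n b => b)).
- by move=> n x y.
- by move=> n x y.
- by move=> n f; exists f.
- move=> n r b f.
  by apply: (congr1 (character_fun b)); apply: character_ext.
- move=> m n mn b f.
  by apply: (congr1 (character_fun b)); apply: character_ext.
Qed.

Theorem corollary4p7 (R : pzRingType) :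
  (forall L : chain_complex R,
     left_level L <-> absolutely_clean (left_dual L)) /\
  (forall L : chain_complex R^c,
     right_level L <-> absolutely_clean (right_dual L)) /\
  (forall A : chain_complex R,
     absolutely_clean A <-> right_level (left_dual A)) /\
  (forall A : chain_complex R^c,
     absolutely_clean A <-> left_level (right_dual A)).
Proof.
split; first exact: left_level_dual.
split; first exact: right_level_dual.
split=> A.
  apply: iff_trans (bidual_absolutely_clean (right_left_bidual A)) _.
  exact: iff_sym (right_level_dual _).
apply: iff_trans (bidual_absolutely_clean (left_right_bidual A)) _.
exact: iff_sym (left_level_dual _).
Qed.
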